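(* Let $\Sigma\subset\mathbb{R}^2$ be a domain, $f:\Sigma\to\mathbb{R}^3$ a front, $\nu$ its unit normal vector, and $p\in\Sigma$ a non-degenerate singular point of the second kind of $f$. Let $\phi$ be the extended height function $\phi(u,v)=\langle f(u,v),\nu(p)\rangle-\langle f(p),\nu(p)\rangle$, defined on a neighborhood of $p$. Then $\phi$ has a $D_4$ singularity at $p$ if and only if $p$ is a parabolic point and not a ridge point of $f$.
   Context: Fronts. A $C^\infty$ map $f:\Sigma\to\mathbb{R}^3$ from a domain $\Sigma\subset(\mathbb{R}^2;u,v)$ is a front if there is a $C^\infty$ unit vector field $\nu:\Sigma\to S^2$ (unit normal vector, Gauss map) with $\langle df_q(X),\nu(q)\rangle=0$ for all $q\in\Sigma$, $X\in T_q\Sigma$, and $(f,\nu):\Sigma\to\mathbb{R}^3\times S^2$ is an immersion. Singular points are the points $q$ with $\operatorname{rank} df_q<2$. Put $\lambda=\det(f_u,f_v,\nu)$; a singular point $p$ is non-degenerate if $d\lambda(p)\neq0$. Then near $p$ the singular set is the image of a regular curve $\gamma$ with $\gamma(0)=p$ (singular curve), and there is a nowhere vanishing vector field $\eta$ along it with $df(\eta)=0$ (null vector field). $p$ is of the first kind if $\det(\gamma',\eta)(0)\neq0$ and of the second kind otherwise. Bounded principal curvature. At each regular point near $p$ there are two principal curvatures with respect to $\nu$. It is known that there is a unique $C^\infty$ function $\kappa$ on a neighborhood of $p$ whose value at every regular point is one of the two principal curvatures (the bounded principal curvature). A principal vector relative to $\kappa$ is a nowhere vanishing $C^\infty$ vector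 field $\boldsymbol V$ near $p$ with $d\nu(\boldsymbol V)=-\kappa\,df(\boldsymbol V)$; it exists and is unique up to nowhere vanishing factors. $p$ is a parabolic point if $\kappa(p)=0$, and a ridge point if $\boldsymbol V\kappa(p)=0$ (directional derivative of $\kappa$ along $\boldsymbol V$). $D_4$ singularity. A function germ with value $0$ at $p$ has a $D_4$ singularity at $p$ if it is $\mathcal R$-equivalent (equal up to a diffeomorphism germ of the source) to $u^3+uv^2$ ($D_4^+$) or $u^3-uv^2$ ($D_4^-$) at $0$. *)

(* Defs.v *)
From HB Require Import structures.
From mathcomp Require Import all_boot all_order all_algebra.
From mathcomp Require Import all_classical all_reals all_analysis.

Set Implicit Arguments.
Unset Strict Implicit.
Unset Printing Implicit Defensive.

Import Order.TTheory GRing.Theory Num.Theory.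
Import numFieldNormedType.Exports.

Local Open Scope classical_set_scope.
Local Open Scope ring_scope.

(* Maps are total functions; every condition below is imposed on an open set,
   where values taken outside of it are irrelevant. [smooth_on] is meant for
   open [U]: differentiability at a point refers to a full neighborhood. *)
Fixpoint Ck_on (R : realType) (V W : normedModType R) (k : nat) (U : set V)
    (F : V -> W) : Prop :=
  match k with
  | 0 => forall x, U x -> {for x, continuous F}
  | j.+1 => (forall x, U x -> differentiable F x) /\
            (forall v, Ck_on j U (fun x => 'D_v F x))
  end.

Definition smooth_on (R : realType) (V W : normedModType R) (U : set V)
    (F : V -> W) : Prop :=
  forall k, Ck_on k U F.

Definition open_nbhd_in (T : topologicalType) (S : set T) (p : T)
    (U : set T) : Prop :=
  [/\ open U, U p & U `<=` S].

Definition dotv (R : realType) (n : nat) (x y : 'rV[R]_n) : R :=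
  \sum_i x 0 i * y 0 i.

Definition immersion_on (R : realType) (V W : normedModType R) (U : set V)
    (F : V -> W) : Prop :=
  smooth_on U F /\ forall q, U q -> injective ('d F q).

(* An immersion into R^3 x S^2 is an immersion into R^3 x R^3 whose second
   component takes values in the submanifold S^2. *)
Definition front_on (R : realType) (Sigma : set 'rV[R]_2)
    (f nu : 'rV[R]_2 -> 'rV[R]_3) : Prop :=
  [/\ smooth_on Sigma f,
      smooth_on Sigma nu,
      (forall q, Sigma q -> dotv (nu q) (nu q) = 1),
      (forall q X, Sigma q -> dotv ('d f q X) (nu q) = 0)
    & immersion_on Sigma (fun q => (f q, nu q))].

(* ['J f q] acts on row vectors: its rows are f_u(q) and f_v(q). *)
Definition singular_point (R : realType) (f : 'rV[R]_2 -> 'rV[R]_3)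
    (q : 'rV[R]_2) : Prop :=
  (\rank ('J f q) < 2)%N.

Definition signed_area_density (R : realType) (f nu : 'rV[R]_2 -> 'rV[R]_3)
    (q : 'rV[R]_2) : R :=
  \det (col_mx ('D_(delta_mx 0 0) f q)
         (col_mx ('D_(delta_mx 0 1) f q) (nu q)) : 'M[R]_(1 + (1 + 1))).

Definition nondegenerate_singular_point (R : realType)
    (f nu : 'rV[R]_2 -> 'rV[R]_3) (p : 'rV[R]_2) : Prop :=
  singular_point f p /\ exists X, 'd (signed_area_density f nu) p X != 0.

Definition sym_ival (R : realType) (e : R) : set R := `]- e, e[.

Definition singular_curve (R : realType) (Sigma : set 'rV[R]_2)
    (f : 'rV[R]_2 -> 'rV[R]_3) (p : 'rV[R]_2) (e : R)
    (gamma : R -> 'rV[R]_2) : Prop :=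
  [/\ smooth_on (sym_ival e) gamma,
      gamma 0 = p,
      (forall t, sym_ival e t -> derive1 gamma t != 0)
    & exists2 W, open_nbhd_in Sigma p W &
        W `&` [set q | singular_point f q] = gamma @` sym_ival e].

Definition null_field_along (R : realType) (f : 'rV[R]_2 -> 'rV[R]_3) (e : R)
    (gamma eta : R -> 'rV[R]_2) : Prop :=
  [/\ smooth_on (sym_ival e) eta,
      (forall t, sym_ival e t -> eta t != 0)
    & forall t, sym_ival e t -> 'd f (gamma t) (eta t) = 0].

(* Whether det(gamma', eta) vanishes at 0 does not depend on the choice of
   gamma and eta. *)
Definition second_kind (R : realType) (Sigma : set 'rV[R]_2)
    (f nu : 'rV[R]_2 -> 'rV[R]_3) (p : 'rV[R]_2) : Prop :=
  nondegenerate_singular_point f nu p /\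
  exists (e : R) (gamma eta : R -> 'rV[R]_2),
    [/\ 0 < e,
        singular_curve Sigma f p e gamma,
        null_field_along f e gamma eta
      & \det (col_mx (derive1 gamma 0) (eta 0) : 'M[R]_(1 + 1)) = 0].

Definition first_form (R : realType) (f : 'rV[R]_2 -> 'rV[R]_3)
    (q : 'rV[R]_2) : 'M[R]_2 :=
  'J f q *m ('J f q)^T.

(* II_ij = - <nu_i, f_j>, which equals <f_ij, nu>. *)
Definition second_form (R : realType) (f nu : 'rV[R]_2 -> 'rV[R]_3)
    (q : 'rV[R]_2) : 'M[R]_2 :=
  - ('J nu q *m ('J f q)^T).

(* II I^-1 is the matrix, acting on row vectors, of the shape operator S
   determined by df (S X) = - dnu X; meaningful at regular points only. *)
Definition principal_curvature (R : realType) (f nu : 'rV[R]_2 -> 'rV[R]_3)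
    (q : 'rV[R]_2) (k : R) : Prop :=
  eigenvalue (second_form f nu q *m invmx (first_form f q)) k.

Definition bounded_principal_curvature (R : realType) (Sigma : set 'rV[R]_2)
    (f nu : 'rV[R]_2 -> 'rV[R]_3) (p : 'rV[R]_2)
    (kappa : 'rV[R]_2 -> R) : Prop :=
  exists U, [/\ open_nbhd_in Sigma p U,
                smooth_on U kappa
              & forall q, U q -> ~ singular_point f q ->
                  principal_curvature f nu q (kappa q)].

Definition principal_vector (R : realType) (Sigma : set 'rV[R]_2)
    (f nu : 'rV[R]_2 -> 'rV[R]_3) (p : 'rV[R]_2)
    (kappa : 'rV[R]_2 -> R) (V : 'rV[R]_2 -> 'rV[R]_2) : Prop :=
  exists U, [/\ open_nbhd_in Sigma p U,
                smooth_on U V,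
                (forall q, U q -> V q != 0)
              & forall q, U q ->
                  'd nu q (V q) = - kappa q *: 'd f q (V q)].

Definition parabolic_point (R : realType) (kappa : 'rV[R]_2 -> R)
    (p : 'rV[R]_2) : Prop :=
  kappa p = 0.

Definition ridge_point (R : realType) (kappa : 'rV[R]_2 -> R)
    (V : 'rV[R]_2 -> 'rV[R]_2) (p : 'rV[R]_2) : Prop :=
  'D_(V p) kappa p = 0.

Definition diffeo_germ (R : realType) (a b : 'rV[R]_2)
    (psi : 'rV[R]_2 -> 'rV[R]_2) : Prop :=
  exists (U W : set 'rV[R]_2) (chi : 'rV[R]_2 -> 'rV[R]_2),
    [/\ open U /\ open W,
        U a /\ psi a = b,
        smooth_on U psi /\ smooth_on W chi,
        (forall x, U x -> W (psi x) /\ chi (psi x) = x)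
      & forall y, W y -> U (chi y) /\ psi (chi y) = y].

Definition R_equivalent (R : realType) (phi : 'rV[R]_2 -> R) (p : 'rV[R]_2)
    (g : 'rV[R]_2 -> R) (b : 'rV[R]_2) : Prop :=
  exists2 psi, diffeo_germ p b psi & \forall q \near p, phi q = g (psi q).

Definition D4_plus (R : realType) (x : 'rV[R]_2) : R :=
  x 0 0 ^+ 3 + x 0 0 * x 0 1 ^+ 2.

Definition D4_minus (R : realType) (x : 'rV[R]_2) : R :=
  x 0 0 ^+ 3 - x 0 0 * x 0 1 ^+ 2.

Definition D4_singularity (R : realType) (phi : 'rV[R]_2 -> R)
    (p : 'rV[R]_2) : Prop :=
  R_equivalent phi p (@D4_plus R) 0 \/ R_equivalent phi p (@D4_minus R) 0.

Definition extended_height (R : realType) (f nu : 'rV[R]_2 -> 'rV[R]_3)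
    (p q : 'rV[R]_2) : R :=
  dotv (f q) (nu p) - dotv (f p) (nu p).

(* Main.v *)
Require Import Defs.
From HB Require Import structures.
From mathcomp Require Import all_boot all_order all_algebra.
From mathcomp Require Import all_classical all_reals all_analysis.
From mathcomp Require Import ring lra.
Import numFieldNormedType.Exports.
Local Open Scope classical_set_scope.
Local Open Scope ring_scope.
Set Implicit Arguments.
Unset Strict Implicit.
Unset Printing Implicit Defensive.
Import Order.TTheory GRing.Theory Num.Theory.

(** Let [phi] be the height function [<f - f(p), nu(p)>], [v] the principal vector
    at [p] and [w] a null vector at [p]. They form a frame: [df(w) = 0], while
    [df(v) = 0] would give [dnu(v) = 0] and contradict the immersion property of
    [(f, nu)]. Write z = x v + y w.

    The function [phi] is critical at [p]. Differentiating [<df, nu> = 0] once shows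
    that its Hessian is [kappa(p) |f_v|^2 x^2] ([height_hessian_principal]), so it
    vanishes exactly at parabolic points. Suppose that it does; then [nu_v = 0], and
    differentiating [<df, nu> = 0] twice ([height_third]) gives the cubic form
    [(v kappa) |f_v|^2 x^3 - 3 <f_vw, nu_w> x y^2]: the coefficient of x^2 y vanishes
    with [nu_v]; that of y^3 is a multiple of [<f_ww, nu_w>], which vanishes because
    [df(eta) = 0] along a singular curve tangent to [w] at a point of the second kind
    ([second_kind_null]); and [<f_vw, nu_w>] is not zero because [dlambda] is not
    ([nondegenerate_transversal]). Hence the form has no multiple linear factor
    exactly when [p] is not a ridge point.

    It remains to see that a germ has a D4 singularity if and only if its 2-jet
    vanishes and its cubic form has no multiple linear factor ([D4_criterion]).
    If [phi = g \o psi] with [g] the homogeneous normal form, comparing the limits of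
    [phi(p + t z) / t^3] shows that the cubic form is [g \o dpsi(p)]. Conversely,
    Taylor's formula with integral remainder writes [phi] as a cubic form in (x, y)
    whose coefficients are smooth functions on the plane. The linear group acts on
    cubic forms without multiple factor with an open orbit, and the inverse function
    theorem in dimension 4 provides a smooth local section M of the orbit map
    ([cubic_normal_form_section]): the form at the point q is pulled back from [g] by
    a matrix M(q) smooth in q. Then [phi] is [g] composed with M(q)(x, y), which
    is a local diffeomorphism by the inverse function theorem in dimension 2. *)

(** * Maps of class C^k *)

Section differentiability.
Context {R : realType} {V W : normedModType R}.
Implicit Types (F G : V -> W) (x v : V).

(** Differentials that are computed by hand, such as those of a local inverse or of an
    integral with a parameter, are established through this criterion. *)
Lemma differentiable_eps F x (L : {linear V -> W}) : continuous L ->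
  (forall e : R, 0 < e ->
     \forall h \near 0, `|F (h + x) - F x - L h| <= e * `|h|) ->
  differentiable F x /\ 'd F x = L :> (V -> W).
Proof.
move=> cL FL.
have FLo : F \o shift x = cst (F x) + L +o_ 0 id.
  apply/eqaddoP => e e0 /=; have := FL e e0.
  by apply: filterS => h; rewrite /= opprD addrA.
have dL := diff_unique cL FLo.
by split=> //; apply/diff_locallyP; rewrite dL.
Qed.

Lemma diff_eps F x : differentiable F x -> forall e : R, 0 < e ->
  \forall h \near 0, `|F (h + x) - F x - 'd F x h| <= e * `|h|.
Proof.
move=> dF e e0; have /eqaddoP/(_ _ e0) := diff_locally dF.
by apply: filterS => h /=; rewrite opprD addrA.
Qed.

Lemma near_eq_differentiable F G x : (\near x, F x = G x) ->
  differentiable F x -> differentiable G x.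
Proof.
move=> FG dF; apply: (proj1 (@differentiable_eps _ _ ('d F x) _ _)).
  exact: diff_continuous.
move=> e e0; have FGx := nbhs_singleton FG.
have : \forall h \near 0, F (h + x) = G (h + x).
  by move: FG; rewrite (near_shift 0 x) /=; apply: filterS => h /=; rewrite subr0.
by apply: filterS2 (diff_eps dF e0) => h + FGh; rewrite FGh FGx.
Qed.

End differentiability.

Section Ck.
Context {R : realType}.
Implicit Types V W Z : normedModType R.

Lemma Ck_onS V W k (U : set V) (F : V -> W) : Ck_on k.+1 U F -> Ck_on k U F.
Proof.
elim: k F => [|k IH] F [dF DF].
  by move=> x Ux; apply: differentiable_continuous; exact: dF.
by split=> // v; apply: IH; exact: DF.
Qed.

Lemma Ck_on_differentiable V W k (U : set V) (F : V -> W) x :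
  Ck_on k.+1 U F -> U x -> differentiable F x.
Proof. by case=> dF _ Ux; exact: dF. Qed.

Lemma smooth_on_differentiable V W (U : set V) (F : V -> W) x :
  smooth_on U F -> U x -> differentiable F x.
Proof. by move=> sF Ux; exact: Ck_on_differentiable (sF 1%N) Ux. Qed.

Lemma smooth_on_derive V W (U : set V) (F : V -> W) v :
  smooth_on U F -> smooth_on U (fun x => 'D_v F x).
Proof. by move=> sF k; exact: (sF k.+1).2. Qed.

Lemma smooth_on_continuous V W (U : set V) (F : V -> W) x :
  smooth_on U F -> U x -> {for x, continuous F}.
Proof. by move=> sF Ux; exact: (sF 0%N). Qed.

Lemma Ck_on_sub V W k (U U' : set V) (F : V -> W) :
  U' `<=` U -> Ck_on k U F -> Ck_on k U' F.
Proof.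
move=> U'U; elim: k F => [|k IH] F; first by move=> cF x /U'U Ux; exact: cF.
by move=> [dF DF]; split=> [x /U'U Ux|v]; [exact: dF | apply: IH; exact: DF].
Qed.

Lemma smooth_on_sub V W (U U' : set V) (F : V -> W) :
  U' `<=` U -> smooth_on U F -> smooth_on U' F.
Proof. by move=> U'U sF k; exact: Ck_on_sub (sF k). Qed.

Lemma open_near_eq V W (U : set V) (F G : V -> W) x :
  open U -> (forall y, U y -> F y = G y) -> U x -> \near x, F x = G x.
Proof.
move=> oU FG Ux; have := open_nbhs_nbhs (conj oU Ux).
by apply: filterS.
Qed.

(** The rules of differentiation hold at the points of U only, so the iterated
    derivatives are rewritten through this lemma. *)
Lemma Ck_on_eq V W k (U : set V) (F G : V -> W) : open U ->
  (forall x, U x -> F x = G x) -> Ck_on k U F -> Ck_on k U G.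
Proof.
move=> oU; elim: k F G => [|k IH] F G FG.
  move=> cF x Ux; have cFx : F @ x --> F x := cF x Ux.
  rewrite /prop_for /continuous_at -(FG _ Ux).
  apply: cvg_trans cFx; apply: near_eq_cvg.
  by apply: (open_near_eq oU _ Ux) => y Uy; rewrite FG.
move=> [dF DF]; split=> [x Ux|v].
  by apply: near_eq_differentiable (dF x Ux); exact: open_near_eq oU FG Ux.
apply: IH (DF v) => x Ux; apply: near_eq_derive; exact: open_near_eq oU FG Ux.
Qed.

Lemma Ck_on_cst V W k (U : set V) (a : W) : Ck_on k U (fun=> a).
Proof.
elim: k a => [|k IH] a; first by move=> x _; exact: cst_continuous.
split=> [x _|v]; first exact: differentiable_cst.
suff -> : (fun x : V => 'D_v (fun=> a) x) = fun=> 0 by exact: IH.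
by apply/funext => x; exact: derive_cst.
Qed.

Lemma differentiable_lin V W Z (L : {linear W -> Z}) (F : V -> W) x :
  continuous L -> differentiable F x -> differentiable (fun y => L (F y)) x.
Proof.
move=> cL dF; apply: differentiable_comp; first exact: dF.
exact: linear_differentiable.
Qed.

Lemma derive_lin V W Z (L : {linear W -> Z}) (F : V -> W) x v :
  continuous L -> differentiable F x ->
  'D_v (fun y => L (F y)) x = L ('D_v F x).
Proof.
move=> cL dF; have dL : differentiable L (F x) by exact: linear_differentiable.
rewrite (deriveE _ dF) (deriveE _ (differentiable_lin cL dF)) (diff_comp dF dL).
by rewrite /= diff_lin.
Qed.

Lemma Ck_on_lin V W Z k (U : set V) (F : V -> W) (L : {linear W -> Z}) :
  open U -> continuous L -> Ck_on k U F -> Ck_on k U (fun x => L (F x)).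
Proof.
move=> oU cL; elim: k F => [|k IH] F.
  by move=> cF x Ux; apply: continuous_comp; [exact: cF | exact: cL].
move=> [dF DF]; split=> [x Ux|v]; first exact: differentiable_lin (dF x Ux).
apply: (Ck_on_eq oU _ (IH _ (DF v))) => x Ux.
by rewrite (derive_lin _ cL (dF x Ux)).
Qed.

Lemma Ck_on_id V k (U : set V) : Ck_on k U (@id V).
Proof.
case: k => [|k]; first by move=> x _; exact: cvg_id.
split=> [x _|v]; first exact: ex_diff.
suff -> : (fun x : V => 'D_v id x) = fun=> v by exact: Ck_on_cst.
by apply/funext => x; exact: derive_id.
Qed.

Lemma Ck_onD V W k (U : set V) (F G : V -> W) : open U ->
  Ck_on k U F -> Ck_on k U G -> Ck_on k U (fun x => F x + G x).
Proof.
move=> oU; elim: k F G => [|k IH] F G.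
  by move=> cF cG x Ux; apply: continuousD; [exact: cF | exact: cG].
move=> [dF DF] [dG DG].
split=> [x Ux|v]; first by apply: differentiableD; [exact: dF|exact: dG].
apply: (Ck_on_eq oU _ (IH _ _ (DF v) (DG v))) => x Ux.
by rewrite deriveD //; apply: diff_derivable; [exact: dF|exact: dG].
Qed.

Lemma Ck_on_sum V W k (U : set V) I (r : seq I) (P : pred I) (F : I -> V -> W) :
  open U -> (forall i, P i -> Ck_on k U (F i)) ->
  Ck_on k U (fun x => \sum_(i <- r | P i) F i x).
Proof.
move=> oU CF; elim: r => [|i r IH].
  by apply: Ck_on_eq (Ck_on_cst k U 0) => // x _; rewrite big_nil.
have [Pi|nPi] := boolP (P i).
  apply: Ck_on_eq (Ck_onD oU (CF i Pi) IH) => // x _.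
  by rewrite big_cons Pi.
by apply: Ck_on_eq IH => // x _; rewrite big_cons (negbTE nPi).
Qed.

Lemma Ck_onM V k (U : set V) (F G : V -> R) : open U ->
  Ck_on k U F -> Ck_on k U G -> Ck_on k U (fun x => F x * G x).
Proof.
move=> oU; elim: k F G => [|k IH] F G.
  by move=> cF cG x Ux; apply: continuousM; [exact: cF | exact: cG].
move=> CF CG; have [dF DF] := CF; have [dG DG] := CG.
split=> [x Ux|v]; first by apply: differentiableM; [exact: dF|exact: dG].
have CFG := Ck_onD oU (IH _ _ (Ck_onS CF) (DG v)) (IH _ _ (Ck_onS CG) (DF v)).
apply: (Ck_on_eq oU _ CFG) => x Ux.
by rewrite deriveM //; apply: diff_derivable; [exact: dF|exact: dG].
Qed.

Lemma Ck_on_prod V k (U : set V) I (r : seq I) (P : pred I) (F : I -> V -> R) :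
  open U -> (forall i, P i -> Ck_on k U (F i)) ->
  Ck_on k U (fun x => \prod_(i <- r | P i) F i x).
Proof.
move=> oU CF; elim: r => [|i r IH].
  by apply: Ck_on_eq (@Ck_on_cst V R k U 1) => // x _; rewrite big_nil.
have [Pi|nPi] := boolP (P i).
  apply: Ck_on_eq (Ck_onM oU (CF i Pi) IH) => // x _.
  by rewrite big_cons Pi.
by apply: Ck_on_eq IH => // x _; rewrite big_cons (negbTE nPi).
Qed.

Lemma Ck_onV V k (U : set V) (F : V -> R) : open U ->
  (forall x, U x -> F x != 0) -> Ck_on k U F -> Ck_on k U (fun x => (F x)^-1).
Proof.
move=> oU F0; elim: k => [|k IH].
  by move=> cF x Ux; apply: continuousV; [exact: F0|exact: cF].
move=> CF; have [dF DF] := CF; have CV := IH (Ck_onS CF).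
split=> [x Ux|v]; first by apply: differentiableV; [exact: dF|exact: F0].
have CN := Ck_onM oU (@Ck_on_cst V R k U (-1)) (Ck_onM oU (Ck_onM oU CV CV) (DF v)).
apply: (Ck_on_eq oU _ CN) => x Ux.
rewrite deriveV ?F0//; last by apply: diff_derivable; exact: dF.
by rewrite /GRing.scale/= expr2 invfM mulN1r mulNr.
Qed.

Lemma smooth_onD V W (U : set V) (F G : V -> W) :
  open U -> smooth_on U F -> smooth_on U G -> smooth_on U (fun x => F x + G x).
Proof. by move=> oU sF sG k; exact: Ck_onD. Qed.

End Ck.

Section open_sets.
Context {R : realType}.
Implicit Types V W : normedModType R.

Lemma continuous_dist V W (F : V -> W) a x :
  {for x, continuous F} -> {for x, continuous (fun y => `|F y - a|)}.
Proof.
by move=> cF; apply: cvg_norm; apply: cvgB; [exact: cF|exact: cvg_cst].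
Qed.

Lemma open_norm_ball V (p : V) (r : R) : open [set x | `|x - p| < r].
Proof.
have -> : [set x | `|x - p| < r] = (fun x => `|x - p|) @^-1` [set z | z < r] by [].
apply: open_comp; last exact: open_lt.
by move=> x _; apply: (@continuous_dist _ _ id) => y; exact: cvg_id.
Qed.

Lemma open_preimage_on V W (U : set V) (O : set W) (F : V -> W) :
  open U -> (forall x, U x -> {for x, continuous F}) -> open O ->
  open [set x | U x /\ O (F x)].
Proof.
move=> oU cF oO; rewrite openE => x [Ux OFx].
have n1 : nbhs x U by exact: open_nbhs_nbhs.
have n2 : nbhs x (F @^-1` O) by apply: (cF x Ux); exact: open_nbhs_nbhs.
exact: filterI n1 n2.
Qed.

End open_sets.

(** * Coordinates, composition and matrix inversion *)

Section linear_maps.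
Context {R : realType}.

Definition matrix_coord m n (i : 'I_m) (j : 'I_n) (M : 'M[R]_(m, n)) : R := M i j.

Fact matrix_coord_is_linear m n (i : 'I_m) (j : 'I_n) :
  linear (@matrix_coord m n i j).
Proof. by move=> a M N; rewrite /matrix_coord !mxE. Qed.

HB.instance Definition _ m n i j := GRing.isLinear.Build R 'M[R]_(m, n) R *%R
  (@matrix_coord m n i j) (@matrix_coord_is_linear m n i j).

(** Finite dimension: a linear map is a sum of multiples of coordinates. *)
Lemma linear_continuous_rV (W : normedModType R) n (L : {linear 'rV[R]_n -> W}) :
  continuous L.
Proof.
have -> : (L : 'rV[R]_n -> W) = fun x => \sum_j x 0 j *: L (delta_mx 0 j).
  apply/funext => x; rewrite {1}(row_sum_delta x) linear_sum.
  by apply: eq_bigr => j _; rewrite linearZ.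
elim: (index_enum _) => [|j r IH] x.
  under [X in continuous_at _ X]eq_fun do rewrite big_nil.
  exact: cst_continuous.
under [X in continuous_at _ X]eq_fun do rewrite big_cons.
have cj : {for x, continuous (fun y : 'rV[R]_n => y 0 j *: L (delta_mx 0 j))}.
  by apply: continuousZr_tmp; exact: coord_continuous.
exact: (continuousD cj (IH x)).
Qed.

End linear_maps.

Section rows.
Context {R : realType}.
Implicit Types V W : normedModType R.

Lemma norm_coord_le m n (M : 'M[R]_(m, n)) i j : `|M i j| <= `|M|.
Proof.
by rewrite [leRHS]/Num.Def.normr/= mx_normrE; exact: (le_bigmax _ _ (i, j)).
Qed.

Lemma norm_mx_le m n (M : 'M[R]_(m, n)) (c : R) : 0 <= c ->
  (forall i j, `|M i j| <= c) -> `|M| <= c.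
Proof.
move=> c0 Mc; rewrite [leLHS]/Num.Def.normr/= mx_normrE.
by apply: bigmax_le => // -[i j] _; exact: Mc.
Qed.

Lemma derive_coord V m n (F : V -> 'M[R]_(m, n)) i j v x : differentiable F x ->
  'D_v (fun y => F y i j) x = 'D_v F x i j.
Proof. by move=> dF; rewrite derive_mx ?mxE//; exact: diff_derivable. Qed.

Lemma differentiable_mx V m n (F : V -> 'M[R]_(m, n)) x :
  (forall i j, differentiable (fun y => F y i j) x) -> differentiable F x.
Proof.
move=> dF.
have -> : F = fun y => \sum_i \sum_j F y i j *: delta_mx i j.
  by apply/funext => y; exact: matrix_sum_delta.
have dsum (I : Type) (r : seq I) (G : I -> V -> 'M[R]_(m, n)) :
    (forall i, differentiable (G i) x) ->
    differentiable (fun y => \sum_(i <- r) G i y) x.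
  move=> dG; elim: r => [|a r IH].
    under [X in differentiable X _]eq_fun do rewrite big_nil.
    exact: differentiable_cst.
  under [X in differentiable X _]eq_fun do rewrite big_cons.
  exact: differentiableD.
by apply: (dsum) => i; apply: dsum => j; apply: differentiableZl; exact: dF.
Qed.

Lemma Ck_on_coord V k (U : set V) m n (F : V -> 'M[R]_(m, n)) i j : open U ->
  Ck_on k U F -> Ck_on k U (fun x => F x i j).
Proof.
by move=> oU; apply: (@Ck_on_lin _ _ _ _ _ _ _ (matrix_coord i j)) => //;
  exact: coord_continuous.
Qed.

Lemma Ck_on_mx V k (U : set V) m n (F : V -> 'M[R]_(m, n)) : open U ->
  (forall i j, Ck_on k U (fun x => F x i j)) -> Ck_on k U F.
Proof.
move=> oU; elim: k F => [|k IH] F CF.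
  move=> x Ux; apply/cvgrPdist_le => e e0; near=> y.
  apply: norm_mx_le; first exact: ltW.
  move=> i j; rewrite !mxE; move: i j; near: y.
  apply: filter_forall => i; apply: filter_forall => j.
  by have /cvgrPdist_le := CF i j x Ux; exact.
have dF x : U x -> differentiable F x.
  by move=> Ux; apply: differentiable_mx => i j; exact: (CF i j).1.
split=> // v; apply: IH => i j; have := (CF i j).2 v.
by apply: Ck_on_eq => // x Ux; rewrite derive_coord//; exact: dF.
Unshelve. all: by end_near. Qed.

Lemma derive_sum_partial W n (G : 'rV[R]_n -> W) x v : differentiable G x ->
  'D_v G x = \sum_j v 0 j *: 'D_(delta_mx 0 j) G x.
Proof.
move=> dG; rewrite deriveE// {1}(row_sum_delta v) linear_sum.
by apply: eq_bigr => j _; rewrite linearZ deriveE.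
Qed.

(** Induction on k: D_v (G \o F) is a sum of products of a coordinate of D_v F with
    the composite of F and a partial derivative of G. *)
Lemma Ck_on_comp V n k (U : set V) (U' : set 'rV[R]_n) (F : V -> 'rV[R]_n)
    (G : 'rV[R]_n -> R) : open U -> (forall x, U x -> U' (F x)) ->
  Ck_on k U F -> Ck_on k U' G -> Ck_on k U (G \o F).
Proof.
move=> oU FU; elim: k G => [|k IH] G.
  by move=> cF cG x Ux; apply: continuous_comp; [exact: cF|exact: cG (FU _ Ux)].
move=> CF CG; have [dF DF] := CF; have [dG DG] := CG.
have dGF x : U x -> differentiable (G \o F) x.
  by move=> Ux; apply: differentiable_comp; [exact: dF|exact: dG (FU _ Ux)].
split=> // v.
have : Ck_on k U (fun x => \sum_j
    'D_v F x 0 j * ('D_(delta_mx 0 j) G \o F) x).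
  apply: Ck_on_sum => // j _; apply: Ck_onM => //.
    by apply: Ck_on_coord => //; exact: DF.
  by apply: IH; [exact: Ck_onS | exact: DG].
apply: Ck_on_eq => // x Ux.
have dGx := dG _ (FU _ Ux).
rewrite (deriveE _ (dGF x Ux)) (diff_comp (dF x Ux) dGx) /=.
by rewrite -(deriveE _ dGx) (derive_sum_partial _ dGx) (deriveE _ (dF x Ux)).
Qed.

Lemma Ck_on_comp_mx V n m p k (U : set V) (U' : set 'rV[R]_n) (F : V -> 'rV[R]_n)
    (G : 'rV[R]_n -> 'M[R]_(m, p)) : open U -> open U' ->
  (forall x, U x -> U' (F x)) ->
  Ck_on k U F -> Ck_on k U' G -> Ck_on k U (G \o F).
Proof.
move=> oU oU' FU CF CG; apply: Ck_on_mx => // i j.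
exact: (Ck_on_comp oU FU CF (Ck_on_coord i j oU' CG)).
Qed.

Lemma Ck_on_det V k (U : set V) n (F : V -> 'M[R]_n) : open U ->
  Ck_on k U F -> Ck_on k U (fun x => \det (F x)).
Proof.
move=> oU CF; apply: Ck_on_sum => // s _; apply: Ck_onM => //.
  exact: Ck_on_cst.
by apply: Ck_on_prod => // i _; exact: Ck_on_coord.
Qed.

(** Cramer's rule. *)
Lemma Ck_on_invmx V k (U : set V) n (F : V -> 'M[R]_n) : open U ->
  (forall x, U x -> F x \in unitmx) ->
  Ck_on k U F -> Ck_on k U (fun x => invmx (F x)).
Proof.
move=> oU Fu CF.
have : Ck_on k U (fun x => \matrix_(i, j) ((\det (F x))^-1 *
    ((-1) ^+ (j + i) * \det (row' j (col' i (F x)))))).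
  apply: Ck_on_mx => // i j.
  under [X in Ck_on _ _ X]eq_fun do rewrite mxE.
  apply: Ck_onM => //.
    apply: Ck_onV => //; last exact: Ck_on_det.
    by move=> x /Fu; rewrite unitmxE unitfE.
  apply: Ck_onM => //; first exact: Ck_on_cst.
  apply: Ck_on_det => //; apply: Ck_on_mx => // a b.
  under [X in Ck_on _ _ X]eq_fun do rewrite !mxE.
  exact: Ck_on_coord.
apply: Ck_on_eq => // x Ux.
by apply/matrixP => i j; rewrite /invmx Fu// !mxE.
Qed.

End rows.

(** * Mean values and symmetry of second derivatives *)

Section mean_value.
Context {R : realType} {V : normedModType R}.

Lemma is_derive_line (W : normedModType R) (F : V -> W) x v t :
  differentiable F (t *: v + x) ->
  is_derive t (1 : R) (fun s : R => F (s *: v + x)) ('D_v F (t *: v + x)).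
Proof.
move=> dF.
have eqF : (fun h : R => h^-1 *: (F ((h *: (1 : R) + t) *: v + x) - F (t *: v + x)))
    = (fun h => h^-1 *: (F (h *: v + (t *: v + x)) - F (t *: v + x))).
  by apply/funext => h; rewrite addrA -scalerDl [h *: 1]mulr1.
have dFv := @diff_derivable _ _ _ F _ v dF.
apply: DeriveDef; first by rewrite /derivable eqF.
by rewrite /derive eqF.
Qed.

Lemma MVT_line (F : V -> R) x v :
  (forall t : R, 0 <= t <= 1 -> differentiable F (t *: v + x)) ->
  exists2 t : R, 0 <= t <= 1 & F (v + x) - F x = 'D_v F (t *: v + x).
Proof.
move=> dF; pose h (s : R) := F (s *: v + x).
have dh (t : R) : 0 <= t <= 1 -> is_derive t (1 : R) h ('D_v F (t *: v + x)).
  by move=> /dF; exact: is_derive_line.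
have [t|t|t] := @MVT R h (fun t => 'D_v F (t *: v + x)) 0 1 ltr01.
- by rewrite in_itv/= => /andP[t0 t1]; apply: dh; rewrite !ltW.
- apply: continuous_in_subspaceT => s; rewrite inE/= in_itv/= => s01.
  by apply: differentiable_continuous; apply/derivable1_diffP; case: (dh s s01).
- rewrite in_itv/= => /andP[t0 t1]; rewrite /h scale1r scale0r add0r subr0 mulr1.
  by move=> ->; exists t => //; rewrite !ltW.
Qed.

Lemma deriveZv (W : normedModType R) (F : V -> W) (a : R) v x :
  differentiable F x -> 'D_(a *: v) F x = a *: 'D_v F x.
Proof. by move=> dF; rewrite !deriveE// linearZ. Qed.

Lemma deriveDv (W : normedModType R) (F : V -> W) v w x :
  differentiable F x -> 'D_(v + w) F x = 'D_v F x + 'D_w F x.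
Proof. by move=> dF; rewrite !deriveE// linearD. Qed.

(** The mean value theorem is applied along v to x |-> g (w + x) - g x, and then
    along w to the derivative of g in the direction v. *)
Lemma second_difference (g : V -> R) (U : set V) p v w : open U -> Ck_on 2 U g ->
  (forall a b : R, 0 <= a <= 1 -> 0 <= b <= 1 -> U (a *: v + (b *: w + p))) ->
  exists a b : R, [/\ 0 <= a <= 1, 0 <= b <= 1 &
    g (v + (w + p)) - g (v + p) - (g (w + p) - g p) =
    'D_w (fun x => 'D_v g x) (a *: v + (b *: w + p))].
Proof.
move=> oU [dg Dg] Uab; have [dDg _] := Dg v.
have i0 : 0 <= (0 : R) <= 1 by rewrite lexx ler01.
have i1 : 0 <= (1 : R) <= 1 by rewrite lexx ler01.
pose k x := g (w + x) - g x.
have Uw (a : R) : 0 <= a <= 1 -> U (w + (a *: v + p)).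
  by move=> a01; have := Uab a 1 a01 i1; rewrite scale1r addrCA.
have U0 (a : R) : 0 <= a <= 1 -> U (a *: v + p).
  by move=> a01; have := Uab a 0 a01 i0; rewrite scale0r add0r.
have dshift x : U (w + x) -> differentiable (fun y => g (w + y)) x /\
    'd (fun y => g (w + y)) x = 'd g (w + x) :> (V -> R).
  move=> Ux; have dgx := dg _ Ux; apply: differentiable_eps => [|e e0].
    exact: diff_continuous.
  by have := diff_eps dgx e0; apply: filterS => h; rewrite addrCA.
have dk x : U (w + x) -> U x -> differentiable k x /\
    'D_v k x = 'D_v g (w + x) - 'D_v g x.
  move=> Uwx Ux; have [d1 e1] := dshift _ Uwx.
  have dk : differentiable k x by apply: differentiableB => //; exact: dg.
  split=> //; rewrite (deriveE _ dk) diffB//; last exact: dg.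
  by rewrite /= e1 -(deriveE _ (dg _ Uwx)) -(deriveE _ (dg _ Ux)).
have [a a01] := @MVT_line k p v (fun a a01 => (dk _ (Uw a a01) (U0 a a01)).1).
rewrite (dk _ (Uw a a01) (U0 a a01)).2 => kE.
have [|b b01 DE] := @MVT_line (fun x => 'D_v g x) (a *: v + p) w.
  by move=> b b01; apply: dDg; rewrite addrCA; exact: Uab.
exists a, b; split; [exact: a01|exact: b01|].
have -> : a *: v + (b *: w + p) = b *: w + (a *: v + p) by rewrite addrCA.
by rewrite -DE -kE /k [v + (w + p)]addrCA; ring.
Qed.

Lemma continuous_eq_of_close_values (A B : V -> R) p :
  {for p, continuous A} -> {for p, continuous B} ->
  (forall r : R, 0 < r -> exists x y, [/\ ball p r x, ball p r y & A x = B y]) ->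
  A p = B p.
Proof.
move=> cA cB AB.
apply/eqP; rewrite -subr_eq0 -normr_le0; apply/ler_addgt0Pr => e e0; rewrite add0r.
have e20 : 0 < e / 2 by rewrite divr_gt0.
have hA := (cvgrPdist_le _ _).1 cA _ e20.
have hB := (cvgrPdist_le _ _).1 cB _ e20.
have : \forall x \near p, `|A p - A x| <= e / 2 /\ `|B p - B x| <= e / 2.
  by near=> x; split; near: x; [exact: hA|exact: hB].
move=> /nbhs_ballP[r /= r0 Br]; have [x [y [/Br[Ax _] /Br[_ By] ABxy]]] := AB r r0.
rewrite -ABxy in By; have -> : A p - B p = (A p - A x) - (B p - A x) by ring.
rewrite (le_trans (ler_normB _ _))//; lra.
Unshelve. all: by end_near. Qed.

(** Schwarz's theorem: the second difference is symmetric in the two directions, and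
    divided by t^2 it is a value near p of each of the mixed derivatives. *)
Lemma derive_comm (g : V -> R) (U : set V) p v w : open U -> Ck_on 2 U g -> U p ->
  'D_v (fun x => 'D_w g x) p = 'D_w (fun x => 'D_v g x) p.
Proof.
move=> oU Cg Up; have [dg Dg] := Cg.
apply: (@continuous_eq_of_close_values (fun x => 'D_v (fun y => 'D_w g y) x)
  (fun x => 'D_w (fun y => 'D_v g y) x) p ((Dg w).2 v p Up) ((Dg v).2 w p Up)).
move=> e e0; have nU : nbhs p U by exact: open_nbhs_nbhs.
have /nbhs_ballP[r' /= r'0 Ur'] := nU.
pose r := Num.min e r'.
have r0 : 0 < r by rewrite lt_min e0.
(* with this t the parallelogram spanned by t v and t w stays in the ball *)
pose t := r / (1 + `|v| + `|w|).
have n0 : 0 < 1 + `|v| + `|w| by rewrite ltr_wpDr// ltr_wpDr.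
have t0 : 0 < t by rewrite divr_gt0.
have rE : r = t * (1 + `|v| + `|w|) by rewrite /t divfK ?gt_eqF.
clearbody t.
have Bab (a b : R) : 0 <= a <= 1 -> 0 <= b <= 1 ->
    ball p r (a *: (t *: v) + (b *: (t *: w) + p)).
  move=> /andP[a0 a1] /andP[b0 b1]; rewrite -ball_normE /ball_/= distrC addrA addrK.
  rewrite (le_lt_trans (ler_normD _ _))// !normrZ !ger0_norm ?(ltW t0)//.
  rewrite rE.
  have := ler_wpM2r (mulr_ge0 (ltW t0) (normr_ge0 v)) a1.
  have := ler_wpM2r (mulr_ge0 (ltW t0) (normr_ge0 w)) b1.
  rewrite !mulrDr; lra.
have Uab (a b : R) : 0 <= a <= 1 -> 0 <= b <= 1 ->
    U (a *: (t *: v) + (b *: (t *: w) + p)).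
  move=> a01 b01; apply: Ur'; apply: le_ball (Bab a b a01 b01).
  by rewrite ge_min lexx orbT.
have Eab (a b : R) : 0 <= a <= 1 -> 0 <= b <= 1 ->
    ball p e (a *: (t *: v) + (b *: (t *: w) + p)).
  move=> a01 b01; apply: le_ball (Bab a b a01 b01).
  by rewrite ge_min lexx.
have Dtt x y q : U q -> 'D_(t *: x) (fun z => 'D_(t *: y) g z) q =
    t * t * 'D_x (fun z => 'D_y g z) q.
  move=> Uq; have dDy := (Dg y).1 q Uq.
  transitivity ('D_(t *: x) (t \*: (fun z => 'D_y g z)) q).
    apply: near_eq_derive; apply: (open_near_eq oU _ Uq) => z Uz.
    exact: deriveZv (dg z Uz).
  rewrite (deriveZ _ (@diff_derivable _ _ _ _ _ (t *: x) dDy)) (deriveZv _ _ dDy).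
  by rewrite /GRing.scale/= mulrA.
have [a [b [a01 b01 E1]]] := second_difference oU Cg Uab.
have Uba (a' b' : R) : 0 <= a' <= 1 -> 0 <= b' <= 1 ->
    U (a' *: (t *: w) + (b' *: (t *: v) + p)).
  by move=> a'01 b'01; rewrite addrCA; exact: Uab.
have [a' [b' [a'01 b'01 E2]]] := second_difference oU Cg Uba.
exists (a' *: (t *: w) + (b' *: (t *: v) + p)).
exists (a *: (t *: v) + (b *: (t *: w) + p)).
split; [by rewrite addrCA; exact: Eab|exact: Eab|].
have tt0 : t * t != 0 by rewrite mulf_neq0 ?gt_eqF.
apply: (mulfI tt0).
apply: etrans (esym (Dtt v w _ (Uba a' b' a'01 b'01))) _.
apply: etrans _ (Dtt w v _ (Uab a b a01 b01)).
apply: etrans (esym E2) _; apply: etrans _ E1.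
by rewrite [t *: w + (t *: v + p)]addrCA; ring.
Qed.

End mean_value.

(** * The inverse function theorem *)

Section fixed_point.
Context {R : realType} {n : nat}.

(** The join of the complete and normed structures of row vectors, over which
    Banach's fixed point theorem is stated. *)
Definition complete_rV : completeNormedModType R :=
  HB.pack_for (completeNormedModType R) 'rV[R]_n
    (Complete.on 'rV[R]_n) (NormedModule.on 'rV[R]_n).

Lemma contraction_fixed_point (B : set 'rV[R]_n) (T : 'rV[R]_n -> 'rV[R]_n) :
  closed B -> B !=set0 -> (forall x, B x -> B (T x)) ->
  (forall x y, B x -> B y -> `|T x - T y| <= 2^-1 * `|x - y|) ->
  exists2 x, B x & x = T x.
Proof.
move=> cB B0 BT lipT; pose X := complete_rV; pose B' : set X := B.
pose TM := isFun.Build X X B' B' T BT.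
pose T' : {fun B' >-> B'} := HB.pack T TM.
have h0 : 0 <= 2^-1 :> R by rewrite invr_ge0.
apply: (@banach_fixed_point R X B' T') => //.
exists (NngNum h0); split=> /=; first by rewrite invf_lt1// ltr1n.
by move=> -[x y] [Bx By] /=; exact: lipT.
Qed.

End fixed_point.

Section inverse_function.
Context {R : realType}.

Lemma mulmxr_linear n m (A : 'M[R]_(n, m)) :
  exists L : {linear 'rV[R]_n -> 'rV[R]_m}, forall x, L x = x *m A.
Proof. by exists (mulmxr A). Qed.

Lemma jacobianE n m (F : 'rV[R]_n -> 'rV[R]_m) x i j :
  differentiable F x -> 'J F x i j = 'D_(delta_mx 0 i) F x 0 j.
Proof. by move=> dF; rewrite (deriveEjacobian _ dF) -rowE [RHS]mxE. Qed.

Lemma Ck_on_jacobian n m k (U : set 'rV[R]_n) (F : 'rV[R]_n -> 'rV[R]_m) :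
  open U -> Ck_on k.+1 U F -> Ck_on k U (fun x => 'J F x).
Proof.
move=> oU [dF DF]; apply: Ck_on_mx => // i j.
have := Ck_on_coord 0 j oU (DF (delta_mx 0 i)).
by apply: Ck_on_eq => // x Ux; rewrite jacobianE//; exact: dF.
Qed.

Lemma convex_ball_line n (p x y : 'rV[R]_n) r (t : R) : 0 <= t <= 1 ->
  `|x - p| < r -> `|y - p| < r -> `|t *: (y - x) + x - p| < r.
Proof.
move=> /andP[t0 t1] xr yr.
have -> : t *: (y - x) + x - p = t *: (y - p) + (1 - t) *: (x - p).
  rewrite !scalerBr !scalerBl !scale1r; apply/rowP => i; rewrite !mxE; ring.
rewrite (le_lt_trans (ler_normD _ _))// !normrZ !ger0_norm ?subr_ge0//.
have [->|tn0] := eqVneq t 0; first by rewrite mul0r add0r subr0 mul1r.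
have tp : 0 < t by rewrite lt0r tn0.
have := ltr_pM2l tp `|y - p| r; rewrite yr => h1.
have h2 : (1 - t) * `|x - p| <= (1 - t) * r by rewrite ler_wpM2l ?subr_ge0// ltW.
lra.
Qed.

(** The mean value theorem on each coordinate, along the segment from x to y; the
    factor n counts the partial derivatives. *)
Lemma lipschitz_of_partials n m (F : 'rV[R]_n -> 'rV[R]_m) p r (c : R) : 0 <= c ->
  (forall x, `|x - p| < r -> differentiable F x) ->
  (forall x, `|x - p| < r -> forall i, `|'D_(delta_mx 0 i) F x| <= c) ->
  forall x y, `|x - p| < r -> `|y - p| < r -> `|F y - F x| <= n%:R * c * `|y - x|.
Proof.
move=> c0 dF DF x y xr yr.
apply: norm_mx_le => [|a j]; first by rewrite !mulr_ge0.
rewrite ord1 {a} !mxE.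
have dFj z : `|z - p| < r -> differentiable (fun w => F w 0 j) z.
  move=> zr; have := differentiable_comp (dF z zr) (differentiable_coord (F z) 0 j).
  exact.
have [|t t01] := @MVT_line _ _ (fun z => F z 0 j) x (y - x).
  by move=> t t01; apply: dFj; exact: convex_ball_line.
rewrite subrK => ->.
have zr := convex_ball_line t01 xr yr.
set z := t *: (y - x) + x in zr *.
rewrite (derive_coord _ _ _ (dF z zr)) (derive_sum_partial _ (dF z zr)) summxE.
rewrite (le_trans (ler_norm_sum _ _ _))//.
apply: (@le_trans _ _ (\sum_(i < n) c * `|y - x|)); last first.
  by rewrite sumr_const card_ord -[leLHS]mulr_natl mulrA.
apply: ler_sum => i _; rewrite mxE normrM mulrC ler_pM//.
  by rewrite (le_trans (norm_coord_le _ _ _))//; exact: DF.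
exact: norm_coord_le.
Qed.

(** After composing [F] with the inverse [A] of its differential at [p], the
    equation [F x = y] is the fixed point equation of
    [x |-> x - F x *m A + y *m A], a contraction near [p]. The differential of the
    inverse [G] at y is the inverse matrix of the Jacobian of [F] at [G y]; if [G] is
    C^k so is this matrix, hence [G] is C^k+1. *)
Theorem inverse_function n (U : set 'rV[R]_n) (F : 'rV[R]_n -> 'rV[R]_n) p :
  open U -> U p -> smooth_on U F -> 'J F p \in unitmx ->
  exists (U' W : set 'rV[R]_n) (G : 'rV[R]_n -> 'rV[R]_n),
    [/\ [/\ open U', U' p & U' `<=` U], open W, smooth_on W G,
      (forall x, U' x -> W (F x) /\ G (F x) = x)
    & forall y, W y -> U' (G y) /\ F (G y) = y].
Proof.
move=> oU Up sF uJ; set A := invmx ('J F p).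
pose k x := x - F x *m A.
have dF x : U x -> differentiable F x by exact: smooth_on_differentiable.
have [LA LAE] := mulmxr_linear A.
have Ck_k j : Ck_on j U k.
  have CFA : Ck_on j U (fun x => (-1 : R) *: LA (F x)).
    have := Ck_on_lin (L := (-1 : R) \*: LA) oU _ (sF j).
    by apply; exact: linear_continuous_rV.
  apply: Ck_on_eq (Ck_onD oU (Ck_on_id j U) CFA) => // x _.
  by rewrite LAE scaleN1r.
have dk x : U x -> differentiable k x by exact: (Ck_k 1%N).1.
have Dk x v : U x -> 'D_v k x = v - 'D_v F x *m A.
  move=> Ux.
  have cLA := linear_continuous_rV (L := LA).
  have dLF := differentiable_lin cLA (dF x Ux).
  have -> : k = id - (fun y => LA (F y)) by apply/funext => z; rewrite /k -LAE.
  have := @deriveB _ _ _ id (fun y => LA (F y)) x v (@derivable_id _ _ x v)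
    (@diff_derivable _ _ _ _ _ v dLF).
  by move=> ->; rewrite derive_id (derive_lin _ cLA (dF x Ux)) LAE.
(* partial derivatives bounded by c make [k] Lipschitz with a constant at most 1/2 *)
pose c : R := (2 * n.+1%:R)^-1.
have c0 : 0 < c by rewrite invr_gt0 mulr_gt0// ltr0n.
have [r r0 [rU rk rJ]] : exists2 r, 0 < r & [/\ forall x, `|x - p| < r -> U x,
    forall x, `|x - p| < r -> forall i, `|'D_(delta_mx 0 i) k x| <= c &
    forall x, `|x - p| < r -> 'J F x \in unitmx].
  have Dk0 i : 'D_(delta_mx 0 i) k p = 0.
    by rewrite Dk// (deriveEjacobian _ (dF p Up)) mulmxK// subrr.
  have nU : \forall x \near p, U x by exact: open_nbhs_nbhs.
  have nk : \forall x \near p, forall i, `|'D_(delta_mx 0 i) k x| <= c.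
    apply: (@filter_forall _ 'I_n (fun i x => `|'D_(delta_mx 0 i) k x| <= c)
      (nbhs p) (nbhs_filter p)) => i.
    have ck : {for p, continuous (fun x => 'D_(delta_mx 0 i) k x)}.
      exact: (Ck_k 1%N).2 (delta_mx 0 i) p Up.
    apply: (@filterS _ _ (nbhs_filter p) _ _ _ ((cvgrPdist_le _ _).1 ck c c0)).
    by move=> x; rewrite Dk0 sub0r normrN.
  have nJ : \forall x \near p, \det ('J F x) != 0.
    have cJ : {for p, continuous (fun x => \det ('J F x))}.
      exact: (@Ck_on_det _ _ 0 U _ _ oU (Ck_on_jacobian oU (sF 1%N)) p Up).
    apply: (cJ [set z | z != 0]); apply: open_nbhs_nbhs; split.
      exact: open_neq.
    by move: uJ; rewrite unitmxE unitfE.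
  have : \forall x \near p, [/\ U x, forall i, `|'D_(delta_mx 0 i) k x| <= c &
      \det ('J F x) != 0].
    by near=> x; split; near: x; [exact: nU|exact: nk|exact: nJ].
  move=> /nbhs_ballP[r r0 Br]; exists r; first exact: r0.
  have Br' x : `|x - p| < r -> ball p r x.
    by rewrite -ball_normE /ball_/= distrC.
  split=> x /Br' /Br [Ux kx Jx]; [exact: Ux|exact: kx|].
  by rewrite unitmxE unitfE.
have lipk x y : `|x - p| < r -> `|y - p| < r -> `|k x - k y| <= 2^-1 * `|x - y|.
  move=> xr yr.
  apply: le_trans (lipschitz_of_partials (ltW c0) (fun x xr => dk x (rU x xr)) rk yr xr) _.
  rewrite ler_wpM2r// /c invfM mulrCA ler_piMr ?invr_ge0// ler_pdivrMr ?ltr0n//.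
  by rewrite mul1r ler_nat.
have FE x y : x = k x + y *m A -> F x = y.
  rewrite /k => xE; have FA : F x *m A = y *m A.
    apply/eqP; rewrite -subr_eq0 -[F x *m A](subKr x) {1}xE.
    by apply/eqP/rowP => i; rewrite !mxE; ring.
  by rewrite -[F x](mulmxKV uJ) FA mulmxKV.
have injF x y : `|x - p| < r -> `|y - p| < r ->
    `|x - y| <= 2 * `|F x *m A - F y *m A|.
  move=> xr yr; have := lipk x y xr yr.
  have -> : x - y = (k x - k y) + (F x *m A - F y *m A).
    rewrite /k; move: (F x *m A) (F y *m A) => a b.
    by apply/rowP => i; rewrite !mxE; ring.
  have := ler_normD (k x - k y) (F x *m A - F y *m A); lra.
have [C C0 AC] := linear_lipschitz (linear_continuous_rV (L := LA)).
pose W := [set y : 'rV[R]_n | `|(y - F p) *m A| < r / 2].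
have norm_sub_continuous (a : 'rV[R]_n) : continuous (fun x : 'rV[R]_n => `|x - a|).
  by move=> x; apply: (@continuous_dist _ _ _ id) => y; exact: cvg_id.
have oW : open W.
  have -> : W = (fun y => `|LA y - LA (F p)|) @^-1` [set z | z < r / 2].
    by apply/seteqP; split=> y; rewrite /W/= -linearB LAE.
  apply: open_comp; last exact: open_lt.
  by move=> y _; apply: continuous_dist; exact: linear_continuous_rV.
(* the closed ball of radius s < r is stable: the contraction moves its centre by
   s / 2 and halves distances *)
have exG y : W y -> exists x, `|x - p| < r /\ F x = y.
  rewrite /W/= => Wy; pose s := 2 * `|(y - F p) *m A|.
  have sr : s < r by rewrite /s mulrC -ltr_pdivlMr.
  have s0 : 0 <= s by rewrite mulr_ge0.
  pose B := [set x : 'rV[R]_n | `|x - p| <= s].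
  have Br x : B x -> `|x - p| < r by move=> Bx; exact: le_lt_trans sr.
  have cB : closed B.
    have -> : B = (fun x => `|x - p|) @^-1` [set z | z <= s] by [].
    apply: preimage_closed; last exact: closed_le.
    by move=> x _; exact: norm_sub_continuous.
  have [|||x z Bx Bz|x Bx xE] := @contraction_fixed_point R n B (fun x => k x + y *m A).
  - exact: cB.
  - by exists p; rewrite /B/= subrr normr0.
  - move=> x Bx; rewrite /B/=.
    have -> : k x + y *m A - p = (k x - k p) + (y - F p) *m A.
      rewrite mulmxBl /k; move: (F x *m A) (F p *m A) (y *m A) => a b c'.
      by apply/rowP => i; rewrite !mxE; ring.
    have pr : `|p - p| < r by rewrite subrr normr0.
    have := lipk x p (Br x Bx) pr; have := ler_normD (k x - k p) ((y - F p) *m A).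
    move: Bx; rewrite /B /s/=; lra.
  - rewrite opprD addrACA subrr addr0.
    exact: lipk (Br x Bx) (Br z Bz).
  - by exists x; split; [exact: Br|exact: FE].
have [G GP] : exists G : 'rV[R]_n -> 'rV[R]_n, forall y, W y ->
    `|G y - p| < r /\ F (G y) = y.
  have /choice[G GP] : forall y, exists x, W y -> `|x - p| < r /\ F x = y.
    move=> y; have [/exG[x xP]|nW] := pselect (W y); first by exists x.
    by exists 0.
  by exists G.
have lipG y z : W y -> W z -> `|G y - G z| <= 2 * C * `|y - z|.
  move=> Wy Wz; have [Gy FGy] := GP y Wy; have [Gz FGz] := GP z Wz.
  rewrite (le_trans (injF _ _ Gy Gz))// FGy FGz -mulrA ler_wpM2l//.
  by rewrite -mulmxBl -LAE.
(* at x = G y, a first order expansion of F is solved for the increment of x *)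
have dG y : W y -> differentiable G y /\
    forall v, 'D_v G y = v *m invmx ('J F (G y)).
  move=> Wy; have [Gyr FGy] := GP y Wy; set x := G y in Gyr FGy *.
  have uJx := rJ x Gyr; set K := invmx ('J F x).
  have [LK LKE] := mulmxr_linear K.
  have [D D0 KD] := linear_lipschitz (linear_continuous_rV (L := LK)).
  suff [dGy DGy] : differentiable G y /\ 'd G y = LK :> ('rV[R]_n -> 'rV[R]_n).
    by split=> [|v]; [exact: dGy|rewrite (deriveE _ dGy) DGy LKE].
  apply: differentiable_eps => [|e e0]; first exact: linear_continuous_rV.
  pose e' := e / (D * (2 * C)).
  have DC0 : 0 < D * (2 * C) by rewrite !mulr_gt0.
  have e'0 : 0 < e' by rewrite divr_gt0.
  have /nbhs_ballP[d d0 dP] := diff_eps (dF x (rU x Gyr)) e'0.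
  have d2C : 0 < d / (2 * C) by rewrite divr_gt0// mulr_gt0.
  have hd : \forall h \near (0 : 'rV[R]_n), `|h| < d / (2 * C).
    apply/nbhs_ballP; exists (d / (2 * C)) => // h.
    by rewrite -ball_normE /ball_/= sub0r normrN.
  have hW : \forall h \near (0 : 'rV[R]_n), W (h + y).
    have /nbhs_ballP[s s0 sW] : nbhs y W by exact: open_nbhs_nbhs.
    apply/nbhs_ballP; exists s => // h; rewrite -ball_normE /ball_/= => hs.
    apply: sW; rewrite -ball_normE /ball_/=.
    by rewrite opprD addrCA subrr addr0 -sub0r.
  near=> h.
  have Why : W (h + y) by near: h; exact: hW.
  have [_ FGh] := GP _ Why.
  set z := G (h + y) - x.
  have zh : `|z| <= 2 * C * `|h|.
    by have := lipG _ _ Why Wy; rewrite addrK.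
  have zd : `|z| < d.
    have hC : `|h| < d / (2 * C) by near: h; exact: hd.
    by rewrite (le_lt_trans zh)// mulrC -ltr_pdivlMr ?mulr_gt0.
  have : `|F (z + x) - F x - 'd F x z| <= e' * `|z|.
    by apply: dP; rewrite -ball_normE /ball_/= sub0r normrN.
  rewrite subrK FGh FGy addrK -(deriveE _ (dF x (rU x Gyr))).
  rewrite (deriveEjacobian _ (dF x (rU x Gyr))) => hz.
  have -> : z - LK h = - LK (h - z *m 'J F x).
    by rewrite !LKE mulmxBl mulmxK// opprB.
  rewrite normrN (le_trans (KD _))//.
  apply: (@le_trans _ _ (D * (e' * (2 * C * `|h|)))).
    by rewrite ler_pM2l// (le_trans hz)// ler_pM2l.
  have -> : D * (e' * (2 * C * `|h|)) = e' * (D * (2 * C)) * `|h| by ring.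
  by rewrite /e' divfK// gt_eqF.
have CG j : Ck_on j W G.
  elim: j => [|j IH].
    by move=> y Wy; apply: differentiable_continuous; exact: (dG y Wy).1.
  split=> [y Wy|v]; first exact: (dG y Wy).1.
  have CJ : Ck_on j W (fun y => invmx ('J F (G y))).
    apply: (Ck_on_invmx oW) => [y Wy|]; first by apply: rJ; exact: (GP y Wy).1.
    apply: (Ck_on_comp_mx oW oU _ IH (Ck_on_jacobian oU (sF j.+1))) => y Wy.
    by apply: rU; exact: (GP y Wy).1.
  have CvJ : Ck_on j W (fun y => v *m invmx ('J F (G y))).
    apply: (Ck_on_mx oW) => a b.
    have CS : Ck_on j W (fun y => \sum_i v a i * invmx ('J F (G y)) i b).
      apply: (@Ck_on_sum R _ R j W _ _ _
        (fun i y => v a i * invmx ('J F (G y)) i b) oW) => i _.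
      apply: (Ck_onM oW); first exact: Ck_on_cst.
      exact: (Ck_on_coord _ _ oW CJ).
    by apply: (Ck_on_eq oW _ CS) => y _; rewrite mxE.
  by apply: (Ck_on_eq oW _ CvJ) => y Wy; rewrite (dG y Wy).2.
exists [set x | `|x - p| < r /\ W (F x)], W, G; split; [|exact: oW|exact: CG| |].
- split=> [| |x [xr _]]; last exact: rU.
    apply: (open_preimage_on (@open_norm_ball R _ p r) _ oW) => x xr.
    exact: differentiable_continuous (dF x (rU x xr)).
  have W0 : W (F p) by rewrite /W/= subrr mul0mx normr0 divr_gt0.
  by split; [rewrite subrr normr0|exact: W0].
- move=> x [xr WFx]; split=> //; have [Gr FG] := GP _ WFx.
  have := injF _ _ Gr xr; rewrite FG subrr normr0 mulr0 normr_le0 subr_eq0.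
  by move/eqP.
- move=> y Wy; have [Gr FG] := GP y Wy; split; last exact: FG.
  by split; [exact: Gr|rewrite FG].
Unshelve. all: by end_near. Qed.

End inverse_function.

(** * Integration over the unit interval *)

Section unit_interval_integral.
Context {R : realType}.
Implicit Types (g h F : R -> R) (c : R).

Definition unit_integral g : R := \int[lebesgue_measure]_(t in `[0, 1]) g t.

Definition continuous01 g := forall t : R, 0 <= t <= 1 -> {for t, continuous g}.

Lemma continuous01_within g : continuous01 g -> {within `[0, 1], continuous g}.
Proof.
move=> cg; apply: continuous_in_subspaceT => t.
by rewrite inE/= in_itv/=; exact: cg.
Qed.

Lemma integrable01 g : continuous01 g ->
  (@lebesgue_measure R).-integrable `[0, 1] (EFin \o g).
Proof.
move=> cg; apply: continuous_compact_integrable; first exact: segment_compact.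
exact: continuous01_within.
Qed.

Lemma eq_unit_integral g h : (forall t : R, 0 <= t <= 1 -> g t = h t) ->
  unit_integral g = unit_integral h.
Proof.
by move=> gh; apply: eq_Rintegral => t; rewrite inE/= in_itv/=; exact: gh.
Qed.

Lemma unit_integralD g h : continuous01 g -> continuous01 h ->
  unit_integral (fun t => g t + h t) = unit_integral g + unit_integral h.
Proof. by move=> cg ch; rewrite /unit_integral RintegralD//; exact: integrable01. Qed.

Lemma unit_integralZ c g : continuous01 g ->
  unit_integral (fun t => c * g t) = c * unit_integral g.
Proof. by move=> cg; rewrite /unit_integral RintegralZl//; exact: integrable01. Qed.

Lemma unit_integralB g h : continuous01 g -> continuous01 h ->
  unit_integral (fun t => g t - h t) = unit_integral g - unit_integral h.
Proof. by move=> cg ch; rewrite /unit_integral RintegralB//; exact: integrable01. Qed.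

Lemma unit_integral_cst c : unit_integral (fun=> c) = c.
Proof.
rewrite /unit_integral Rintegral_cst//= lebesgue_measure_itv/= lte_fin ltr01.
by rewrite -EFinB subr0 mulr1.
Qed.

Lemma unit_integral_bound g c : continuous01 g ->
  (forall t : R, 0 <= t <= 1 -> `|g t| <= c) -> `|unit_integral g| <= c.
Proof.
move=> cg gc; rewrite /unit_integral.
rewrite (le_trans (le_normr_Rintegral _ (integrable01 cg)))//.
rewrite -[leRHS]unit_integral_cst; apply: le_Rintegral => //.
- by apply: (@integrable01 (fun t => `|g t|)) => t t01; apply: cvg_norm; exact: cg.
- by apply: (@integrable01 (fun=> c)) => t _; exact: cvg_cst.
Qed.

Lemma unit_integral_derive F g : continuous01 g ->
  (forall t : R, 0 <= t <= 1 -> is_derive t (1 : R) F (g t)) ->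
  unit_integral g = F 1 - F 0.
Proof.
move=> cg dF; have cF (t : R) : 0 <= t <= 1 -> {for t, continuous F}.
  move=> t01; apply: differentiable_continuous; apply/derivable1_diffP.
  by case: (dF t t01).
have i0 : 0 <= (0 : R) <= 1 by rewrite lexx ler01.
have i1 : 0 <= (1 : R) <= 1 by rewrite lexx ler01.
rewrite /unit_integral /Rintegral (@continuous_FTC2 _ _ F)//.
- exact: continuous01_within.
- split.
  + move=> t; rewrite in_itv/= => /andP[t0 t1].
    by have [|] := dF t; first by rewrite !ltW.
  + exact/cvg_at_right_filter/cF.
  + exact/cvg_at_left_filter/cF.
- move=> t; rewrite in_itv/= => /andP[t0 t1].
  by rewrite derive1E; have [|_ ->] := dF t; first by rewrite !ltW.
Qed.

End unit_interval_integral.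

Section moment.
Context {R : realType}.

(** By compactness of the unit interval, the modulus of continuity of [Phi] at the
    points of the path can be chosen independently of the point. *)
Lemma uniform_continuity_on_path (V : normedModType R) (U : set V) (Phi : V -> R)
    (x : R -> V) (e : R) : open U ->
  (forall y, U y -> {for y, continuous Phi}) -> continuous x ->
  (forall t : R, 0 <= t <= 1 -> U (x t)) -> 0 < e ->
  \forall h \near 0, forall t : R, 0 <= t <= 1 ->
    U (h + x t) /\ `|Phi (h + x t) - Phi (x t)| <= e.
Proof.
move=> oU cPhi cx Ux e0.
have K : near_covering (`[0, 1] : set R).
  by apply/compact_near_coveringP; exact: segment_compact.
pose P (h : V) (t : R) := U (h + x t) /\ `|Phi (h + x t) - Phi (x t)| <= e.
have := K V (nbhs (0 : V)) P (nbhs_filter _).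
have H (t : R) : `[0, 1]%classic t -> \forall t' \near t & h \near (0 : V), P h t'.
  rewrite /= in_itv/= => t01.
  have e20 : 0 < e / 2 by rewrite divr_gt0.
  have nU : nbhs (x t) U by apply: open_nbhs_nbhs; split=> //; exact: Ux.
  have nPhi := (cvgrPdist_le _ _).1 (cPhi _ (Ux t t01)) _ e20.
  have nUPhi : nbhs (x t) (U `&` [set y | `|Phi (x t) - Phi y| <= e / 2]).
    by apply: filterI => //; exact: nPhi (nbhs_filter _).
  have /nbhs_ballP[d d0 dP] := nUPhi.
  have d20 : 0 < d / 2 by rewrite divr_gt0.
  have nx := (cvgrPdist_lt _ _).1 (cx t) _ d20.
  exists ([set t' | `|x t - x t'| < d / 2], ball (0 : V) (d / 2)) => /=.
    by split; [exact: nx|exact: nbhsx_ballx].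
  move=> [t' h] /= [xt']; rewrite -ball_normE /ball_/= sub0r normrN => hd.
  have b1 : ball (x t) d (x t').
    rewrite -ball_normE /ball_/= (lt_le_trans xt')//.
    by rewrite ler_pdivrMr// ler_peMr// ?ler1n// ltW.
  have b2 : ball (x t) d (h + x t').
    rewrite -ball_normE /ball_/= opprD addrCA.
    rewrite (le_lt_trans (ler_normD _ _))// normrN [ltRHS]splitr ltrD//.
  have [_ P1] := dP _ b1; have [P0 P2] := dP _ b2; split=> //.
  have -> : Phi (h + x t') - Phi (x t') =
    (Phi (x t) - Phi (x t')) - (Phi (x t) - Phi (h + x t')) by ring.
  by rewrite (le_trans (ler_normB _ _))// [leRHS]splitr lerD.
move=> /(_ H); apply: (@filterS _ _ (nbhs_filter _)) => h hP t t01.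
by apply: hP; rewrite /= in_itv.
Qed.

End moment.

(** * Weighted averages along segments and Taylor's formula *)

(** The terms telescope; here [h1] and [h2] are successive derivatives of [h0]. *)
Lemma is_derive_taylor3 (R : realType) (h0 h1 h2 : R -> R) (a t : R) :
  is_derive t (1 : R) h0 (h1 t) -> is_derive t (1 : R) h1 (h2 t) ->
  is_derive t (1 : R) h2 a ->
  is_derive t (1 : R)
    (fun s => h0 s + (1 - s) * h1 s + 2^-1 * (1 - s) ^+ 2 * h2 s)
    (2^-1 * (1 - t) ^+ 2 * a).
Proof.
move=> d0 d1 d2; pose l : R -> R := cst 1 - id.
have dl : is_derive t (1 : R) l (-1).
  by apply: is_derive_eq; rewrite sub0r.
have -> : (fun s => h0 s + (1 - s) * h1 s + 2^-1 * (1 - s) ^+ 2 * h2 s) =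
    h0 + l * h1 + 2^-1 *: (l * l * h2).
  by apply/funext => s; rewrite expr2 -mulrA.
have dM1 := is_deriveM dl d1; have dll := is_deriveM dl dl.
have dM2 := is_deriveM dll d2; have dZ := is_deriveZ 2^-1 dM2.
have dD := is_deriveD (is_deriveD d0 dM1) dZ.
apply: (is_derive_eq dD); rewrite /GRing.scale/= /l.
have -> : (cst 1 - id : R -> R) t = 1 - t by [].
have -> : ((cst 1 - id : R -> R) * (cst 1 - id)) t = (1 - t) * (1 - t) by [].
by field.
Qed.

Section radial_average.
Context {R : realType} {n : nat}.
Variables (p : 'rV[R]_n) (r : R).
Let B := [set x : 'rV[R]_n | `|x - p| < r].

Definition segment (q : 'rV[R]_n) (t : R) : 'rV[R]_n := t *: (q - p) + p.

Lemma continuous_segment q : continuous (segment q).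
Proof.
move=> t; apply: differentiable_continuous; apply: differentiableD.
  by apply: differentiableZl; exact: ex_diff.
exact: differentiable_cst.
Qed.

Lemma segment_in_ball q (t : R) : B q -> 0 <= t <= 1 -> B (segment q t).
Proof.
rewrite /B/= /segment addrK normrZ => qr /andP[t0 t1].
by rewrite ger0_norm// (le_lt_trans _ qr)// ler_piMl.
Qed.

(** Remainders of Taylor's formula at [p] have this form. *)
Definition radial_average (w : R -> R) (G : 'rV[R]_n -> R) q : R :=
  unit_integral (fun t => w t * G (segment q t)).

(** Differentiating an average multiplies its weight by t; the bound by 1 is
    preserved, which makes one estimate serve for all orders. *)
Definition weight (w : R -> R) :=
  continuous w /\ forall t : R, 0 <= t <= 1 -> `|w t| <= 1.

Lemma weight_mul_id w : weight w -> weight (fun t => t * w t).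
Proof.
move=> [cw w1]; split=> [t|t t01].
  by apply: continuousM; [exact: cvg_id|exact: cw].
have /andP[t0 t1] := t01; rewrite normrM (ger0_norm t0).
by rewrite mulr_ile1// w1.
Qed.

Lemma continuous01_radial w G q : weight w ->
  (forall x, B x -> {for x, continuous G}) -> B q ->
  continuous01 (fun t => w t * G (segment q t)).
Proof.
move=> [cw _] cG Bq t t01; apply: continuousM; first exact: cw.
apply: (@continuous_comp _ _ _ (segment q) G); first exact: continuous_segment.
exact: cG (segment_in_ball Bq t01).
Qed.

(** Differentiation under the integral sign. The error of the first order expansion of
    G at the points of the segment is uniformly small, by the mean value theorem and
    the uniform continuity of the partial derivatives along the segment. *)
Lemma diff_radial_average w G q : weight w -> Ck_on 1 B G -> B q ->
  differentiable (radial_average w G) q /\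
  forall v, 'D_v (radial_average w G) q =
    radial_average (fun t => t * w t) (fun x => 'D_v G x) q.
Proof.
move=> ww CG Bq; have [dG DG] := CG.
have oB : open B by exact: open_norm_ball.
have tww := weight_mul_id ww.
have cG x : B x -> {for x, continuous G}.
  by move=> Bx; exact: differentiable_continuous (dG x Bx).
have cD v : continuous01 (fun t => t * w t * 'D_v G (segment q t)).
  apply: (@continuous01_radial (fun t => t * w t) (fun x => 'D_v G x)) => //.
  exact: DG.
pose Lf v := radial_average (fun t => t * w t) (fun x => 'D_v G x) q.
have Llin : linear Lf.
  move=> a u v; rewrite /Lf /radial_average.
  have cau : continuous01 (fun t => a * (t * w t * 'D_u G (segment q t))).
    move=> t t01; apply: continuousM; first exact: cvg_cst.
    exact: cD.
  rewrite /GRing.scale/= -(unit_integralZ a (cD u)) -(unit_integralD cau (cD v)).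
  apply: eq_unit_integral => t t01.
  have dGt := dG _ (segment_in_ball Bq t01).
  rewrite (deriveDv _ _ dGt) (deriveZv _ _ dGt).
  by rewrite mulrDr /GRing.scale/= mulrCA.
pose LM := GRing.isLinear.Build R 'rV[R]_n R *%R Lf Llin.
pose L : {linear 'rV[R]_n -> R} := HB.pack Lf LM.
suff [dA DA] : differentiable (radial_average w G) q /\
    'd (radial_average w G) q = L :> ('rV[R]_n -> R).
  by split=> // v; rewrite (deriveE _ dA) DA.
apply: differentiable_eps => [|e e0]; first exact: linear_continuous_rV.
pose e' := e / n.+1%:R.
have e'0 : 0 < e' by rewrite divr_gt0.
have near_j (j : 'I_n) : \forall h \near (0 : 'rV[R]_n), forall t : R, 0 <= t <= 1 ->
    B (h + segment q t) /\
    `|'D_(delta_mx 0 j) G (h + segment q t) - 'D_(delta_mx 0 j) G (segment q t)| <= e'.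
  exact: (uniform_continuity_on_path oB (DG _) (@continuous_segment q)
    (fun t => segment_in_ball Bq) e'0).
have near0 : \forall h \near (0 : 'rV[R]_n), forall t : R, 0 <= t <= 1 ->
    B (h + segment q t) /\ `|G (h + segment q t) - G (segment q t)| <= 1.
  exact: (uniform_continuity_on_path oB cG (@continuous_segment q)
    (fun t => segment_in_ball Bq) ltr01).
have near_all := @filter_forall _ 'I_n _ _ (nbhs_filter (0 : 'rV[R]_n)) near_j.
pose P0 h := forall t : R, 0 <= t <= 1 ->
  B (h + segment q t) /\ `|G (h + segment q t) - G (segment q t)| <= 1.
pose P1 h := forall j (t : R), 0 <= t <= 1 -> B (h + segment q t) /\
  `|'D_(delta_mx 0 j) G (h + segment q t) - 'D_(delta_mx 0 j) G (segment q t)| <= e'.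
have near_both : nbhs (0 : 'rV[R]_n) (P0 `&` P1) by exact: filterI near0 near_all.
have /nbhs_ballP[d d0 dP] := near_both.
apply/nbhs_ballP; exists d => // h hd.
have dP' (t s : R) : 0 <= s <= 1 -> 0 <= t <= 1 -> ball (0 : 'rV[R]_n) d (s *: (t *: h)).
  move=> /andP[s0 s1] /andP[t0 t1]; move: hd; rewrite -!ball_normE /ball_/= !sub0r !normrN.
  rewrite !normrZ !ger0_norm// => hd; rewrite mulrA (le_lt_trans _ hd)// ler_piMl//.
  by rewrite mulr_ile1.
have segE t : segment (h + q) t = t *: h + segment q t.
  by rewrite /segment -addrA scalerDr addrA.
have err (t : R) : 0 <= t <= 1 ->
    `|G (segment (h + q) t) - G (segment q t) - t * 'D_h G (segment q t)| <= e * `|h|.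
  move=> t01; rewrite segE.
  have Bst (s : R) : 0 <= s <= 1 -> B (s *: (t *: h) + segment q t).
    by move=> s01; have [/(_ t t01)[]] := dP _ (dP' t s s01 t01).
  have [s s01 ->] := MVT_line (fun s s01 => dG _ (Bst s s01)).
  have /andP[t0 t1] := t01.
  have dGt := dG _ (segment_in_ball Bq t01).
  have dGs := dG _ (Bst s s01).
  rewrite (deriveZv _ _ dGs) /GRing.scale/= -mulrBr normrM (ger0_norm t0).
  rewrite (le_trans (ler_piMl _ t1))//.
  rewrite (derive_sum_partial _ dGt) (derive_sum_partial _ dGs) -sumrB.
  rewrite (le_trans (ler_norm_sum _ _ _))//.
  apply: (@le_trans _ _ (\sum_(j < n) `|h| * e')).
    apply: ler_sum => j _; rewrite /GRing.scale/= -mulrBr normrM ler_pM//.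
      exact: norm_coord_le.
    by have [_ /(_ j t t01)[]] := dP _ (dP' t s s01 t01).
  rewrite sumr_const card_ord -[leLHS]mulr_natl mulrCA mulrC ler_wpM2r//.
  by rewrite /e' mulrCA ler_piMr ?(ltW e0)// ler_pdivrMr ?ltr0n// mul1r ler_nat.
have Bh : B (h + q).
  have i1 : 0 <= (1 : R) <= 1 by rewrite lexx ler01.
  by have [/(_ 1 i1)[+ _] _] := dP h hd; rewrite /segment scale1r subrK.
have cA := continuous01_radial ww cG Bq.
have cAh := continuous01_radial ww cG Bh.
have cB : continuous01 (fun t => w t * G (segment (h + q) t) - w t * G (segment q t)).
  by move=> t t01; apply: continuousB; [exact: cAh|exact: cA].
have cC : continuous01 (fun t => w t * G (segment (h + q) t) - w t * G (segment q t)
    - t * w t * 'D_h G (segment q t)).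
  by move=> t t01; apply: continuousB; [exact: cB|exact: cD].
rewrite /= /Lf /radial_average -(unit_integralB cAh cA) -(unit_integralB cB (cD h)).
apply: unit_integral_bound => // t t01.
have -> : w t * G (segment (h + q) t) - w t * G (segment q t)
    - t * w t * 'D_h G (segment q t) =
    w t * (G (segment (h + q) t) - G (segment q t) - t * 'D_h G (segment q t)) by ring.
rewrite normrM -[leRHS]mul1r ler_pM//; [exact: ww.2|exact: err].
Qed.

Lemma smooth_radial_average w G : weight w -> smooth_on B G ->
  smooth_on B (radial_average w G).
Proof.
move=> ww sG k; elim: k w G ww sG => [|k IH] w G ww sG.
  move=> q Bq; apply: differentiable_continuous.
  exact: (diff_radial_average ww (sG 1%N) Bq).1.
split=> [q Bq|v]; first exact: (diff_radial_average ww (sG 1%N) Bq).1.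
have CDk := IH _ _ (weight_mul_id ww) (smooth_on_derive v sG).
apply: (Ck_on_eq (@open_norm_ball R _ p r) _ CDk) => q Bq.
by rewrite (diff_radial_average ww (sG 1%N) Bq).2.
Qed.

Lemma weight_taylor3 : weight (fun t => 2^-1 * (1 - t) ^+ 2).
Proof.
split=> [t|t /andP[t0 t1]].
  have cl : {for t, continuous (fun t : R => 1 - t)}.
    by apply: continuousB; [exact: cvg_cst|exact: cvg_id].
  have c2 : {for t, continuous (fun=> 2^-1 : R)} by exact: cvg_cst.
  exact: (continuousM c2 (continuousM cl cl)).
have l0 : 0 <= 1 - t by rewrite subr_ge0.
rewrite ger0_norm ?mulr_ge0 ?exprn_ge0 ?invr_ge0//.
by rewrite mulr_ile1 ?exprn_ge0 ?invr_ge0 ?exprn_ile1 ?gerBl// invf_le1// ler1n.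
Qed.

(** Integration of [is_derive_taylor3] along the segment from p to z + p. *)
Lemma taylor3 (g : 'rV[R]_n -> R) z : smooth_on B g -> B (z + p) ->
  g (z + p) = g p + 'D_z g p + 2^-1 * 'D_z (fun x => 'D_z g x) p +
    radial_average (fun t => 2^-1 * (1 - t) ^+ 2)
      (fun x => 'D_z (fun y => 'D_z (fun u => 'D_z g u) y) x) (z + p).
Proof.
move=> sg Bz; pose g1 x := 'D_z g x; pose g2 x := 'D_z g1 x; pose g3 x := 'D_z g2 x.
have s1 : smooth_on B g1 := smooth_on_derive z sg.
have s2 : smooth_on B g2 := smooth_on_derive z s1.
have s3 : smooth_on B g3 := smooth_on_derive z s2.
have segE t : segment (z + p) t = t *: z + p by rewrite /segment addrK.
have Bt (t : R) : 0 <= t <= 1 -> B (t *: z + p).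
  by move=> t01; rewrite -segE; exact: segment_in_ball.
have line (h : 'rV[R]_n -> R) (t : R) : smooth_on B h -> 0 <= t <= 1 ->
    is_derive t (1 : R) (fun s => h (s *: z + p)) ('D_z h (t *: z + p)).
  by move=> sh /Bt Btz; apply: is_derive_line; exact: smooth_on_differentiable sh Btz.
pose F t := g (t *: z + p) + (1 - t) * g1 (t *: z + p) +
  2^-1 * (1 - t) ^+ 2 * g2 (t *: z + p).
have dF (t : R) : 0 <= t <= 1 ->
    is_derive t (1 : R) F (2^-1 * (1 - t) ^+ 2 * g3 (segment (z + p) t)).
  move=> t01; rewrite segE.
  exact: is_derive_taylor3 (line g t sg t01) (line g1 t s1 t01) (line g2 t s2 t01).
have cg : continuous01 (fun t => 2^-1 * (1 - t) ^+ 2 * g3 (segment (z + p) t)).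
  apply: continuous01_radial => //; first exact: weight_taylor3.
  by move=> x Bx; exact: smooth_on_continuous s3 Bx.
have F1 : F 1 = g (z + p).
  by rewrite /F scale1r subrr expr0n/= mulr0 !mul0r !addr0.
have F0 : F 0 = g p + g1 p + 2^-1 * g2 p.
  by rewrite /F scale0r add0r subr0 expr1n mulr1 mul1r.
transitivity (g p + g1 p + 2^-1 * g2 p +
    unit_integral (fun t => 2^-1 * (1 - t) ^+ 2 * g3 (segment (z + p) t))).
  rewrite (unit_integral_derive cg dF) F1 F0.
  by move: (g (z + p)) (g p) (g1 p) (g2 p) => a b c d; ring.
by [].
Qed.

End radial_average.

(** * Taylor's formula in a frame of two vectors *)

Section cubic_expansion.
Context {R : realType} {n : nat}.
Implicit Types (U : set 'rV[R]_n) (g phi : 'rV[R]_n -> R) (x y : R).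

Definition derive2 a b phi u := 'D_a (fun u' => 'D_b phi u') u.
Definition derive3 a b c phi u := 'D_a (fun u' => derive2 b c phi u') u.

(** Three times the polarized third derivative. *)
Definition derive3_mixed v w phi u :=
  derive3 v v w phi u + derive3 v w v phi u + derive3 w v v phi u.

Lemma smooth_derive3 U a b c phi : smooth_on U phi -> smooth_on U (derive3 a b c phi).
Proof. by move=> s; do 3!apply: smooth_on_derive. Qed.

Lemma derive_combv U g v w x y u : smooth_on U g -> U u ->
  'D_(x *: v + y *: w) g u = x * 'D_v g u + y * 'D_w g u.
Proof.
move=> sg Uu; have dg := smooth_on_differentiable sg Uu.
by rewrite (deriveDv _ _ dg) !(deriveZv _ _ dg).
Qed.

Lemma derive_comb U g g1 g2 x y a u : open U ->
  (forall u', U u' -> g u' = x * g1 u' + y * g2 u') ->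
  smooth_on U g1 -> smooth_on U g2 -> U u ->
  'D_a g u = x * 'D_a g1 u + y * 'D_a g2 u.
Proof.
move=> oU gE s1 s2 Uu.
have d1 := @diff_derivable _ _ _ _ _ a (smooth_on_differentiable s1 Uu).
have d2 := @diff_derivable _ _ _ _ _ a (smooth_on_differentiable s2 Uu).
transitivity ('D_a (x *: g1 + y *: g2) u).
  by apply: near_eq_derive; exact: open_near_eq oU _ Uu.
have z1 : derivable (x *: g1) u a by exact: derivableZ.
have z2 : derivable (y *: g2) u a by exact: derivableZ.
rewrite (deriveD z1 z2).
by rewrite (deriveZ _ d1) (deriveZ _ d2).
Qed.

Lemma derive2_comb U phi v w x y u : open U -> smooth_on U phi -> U u ->
  let z := x *: v + y *: w in
  derive2 z z phi u = x ^+ 2 * derive2 v v phi u +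
    x * y * (derive2 v w phi u + derive2 w v phi u) + y ^+ 2 * derive2 w w phi u.
Proof.
move=> oU s Uu z.
have sv := smooth_on_derive v s; have sw := smooth_on_derive w s.
have zE u' : U u' -> 'D_z phi u' = x * 'D_v phi u' + y * 'D_w phi u'.
  by move=> Uu'; exact: derive_combv s Uu'.
have e1 : derive2 z z phi u =
    x * 'D_z (fun u => 'D_v phi u) u + y * 'D_z (fun u => 'D_w phi u) u.
  exact: derive_comb oU zE sv sw Uu.
have e2 : 'D_z (fun u => 'D_v phi u) u = x * derive2 v v phi u + y * derive2 w v phi u.
  exact: derive_combv sv Uu.
have e3 : 'D_z (fun u => 'D_w phi u) u = x * derive2 v w phi u + y * derive2 w w phi u.
  exact: derive_combv sw Uu.
have alg (a b c d : R) : x * (x * a + y * b) + y * (x * c + y * d) =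
    x ^+ 2 * a + x * y * (c + b) + y ^+ 2 * d by ring.
apply: (etrans e1); apply: (etrans (congr2 (fun a b => x * a + y * b) e2 e3)).
exact: alg.
Qed.

Lemma derive3_comb U phi v w x y u : open U -> smooth_on U phi -> U u ->
  let z := x *: v + y *: w in
  derive3 z z z phi u = x ^+ 3 * derive3 v v v phi u +
    x ^+ 2 * y * derive3_mixed v w phi u + x * y ^+ 2 * derive3_mixed w v phi u +
    y ^+ 3 * derive3 w w w phi u.
Proof.
move=> oU s Uu z.
have sv := smooth_on_derive v s; have sw := smooth_on_derive w s.
have zE u' : U u' -> 'D_z phi u' = x * 'D_v phi u' + y * 'D_w phi u'.
  by move=> Uu'; exact: derive_combv s Uu'.
have s2v := smooth_on_derive z sv; have s2w := smooth_on_derive z sw.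
have zzE u' : U u' -> derive2 z z phi u' =
    x * 'D_z (fun u => 'D_v phi u) u' + y * 'D_z (fun u => 'D_w phi u) u'.
  by move=> Uu'; exact: derive_comb oU zE sv sw Uu'.
have e1 : derive3 z z z phi u = x * derive2 z z (fun u => 'D_v phi u) u +
    y * derive2 z z (fun u => 'D_w phi u) u.
  exact: derive_comb oU zzE s2v s2w Uu.
have e2 := derive2_comb v w x y oU sv Uu; have e3 := derive2_comb v w x y oU sw Uu.
have alg (a b c d a' b' c' d' : R) :
    x * (x ^+ 2 * a + x * y * (b + c) + y ^+ 2 * d) +
    y * (x ^+ 2 * a' + x * y * (b' + c') + y ^+ 2 * d') =
    x ^+ 3 * a + x ^+ 2 * y * (a' + b + c) + x * y ^+ 2 * (d + c' + b') + y ^+ 3 * d'.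
  by ring.
apply: (etrans e1); apply: (etrans (congr2 (fun a b => x * a + y * b) e2 e3)).
exact: alg.
Qed.

End cubic_expansion.

Section taylor_expansion.
Context {R : realType} {n : nat}.
Variables (p : 'rV[R]_n) (r : R).
Let B := [set x : 'rV[R]_n | `|x - p| < r].

Definition cubic_average (T : 'rV[R]_n -> R) :=
  radial_average p (fun t => 2^-1 * (1 - t) ^+ 2) T.

Lemma smooth_cubic_average T : smooth_on B T -> smooth_on B (cubic_average T).
Proof. by apply: smooth_radial_average; exact: weight_taylor3. Qed.

(** 1/6 is the integral of (1 - t)^2 / 2 over the unit interval. *)
Lemma cubic_average_center T : cubic_average T p = 6^-1 * T p.
Proof.
rewrite /cubic_average /radial_average /segment subrr.
pose F := (fun t : R => - 6^-1 * T p * (1 - t) ^+ 3).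
have dF (t : R) : 0 <= t <= 1 ->
    is_derive t (1 : R) F (2^-1 * (1 - t) ^+ 2 * T (t *: 0 + p)).
  move=> _; rewrite scaler0 add0r; pose l : R -> R := cst 1 - id.
  have dl : is_derive t (1 : R) l (-1) by apply: is_derive_eq; rewrite sub0r.
  have -> : F = (- 6^-1 * T p) *: (l * l * l).
    by apply/funext => s; rewrite /F !exprS expr0 mulr1 -[in RHS]mulrA.
  have dll := is_deriveM dl dl.
  apply: (is_derive_eq (is_deriveZ (- 6^-1 * T p) (is_deriveM dll dl))).
  rewrite /GRing.scale/=.
  have -> : (l * l) t = (1 - t) * (1 - t) by [].
  have -> : l t = 1 - t by [].
  by field.
have cF : continuous01 (fun t => 2^-1 * (1 - t) ^+ 2 * T (t *: 0 + p)).
  move=> t _; have cl : {for t, continuous (fun t : R => 1 - t)}.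
    by apply: continuousB; [exact: cvg_cst|exact: cvg_id].
  have c2 : {for t, continuous (fun=> 2^-1 : R)} by exact: cvg_cst.
  have cT : {for t, continuous (fun t : R => T (t *: 0 + p))}.
    have -> : (fun t : R => T (t *: 0 + p)) = fun=> T p.
      by apply/funext => s; rewrite scaler0 add0r.
    exact: cvg_cst.
  exact: (continuousM (continuousM c2 (continuousM cl cl)) cT).
rewrite (unit_integral_derive cF dF) /F subrr subr0 expr1n expr0n/=.
by rewrite mulr0 sub0r mulr1 mulNr opprK.
Qed.

Lemma cubic_averageD T1 T2 q : smooth_on B T1 -> smooth_on B T2 -> B q ->
  cubic_average (fun u => T1 u + T2 u) q = cubic_average T1 q + cubic_average T2 q.
Proof.
move=> s1 s2 Bq; rewrite /cubic_average /radial_average.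
have c1 := continuous01_radial weight_taylor3
  (fun x Bx => smooth_on_continuous s1 Bx) Bq.
have c2 := continuous01_radial weight_taylor3
  (fun x Bx => smooth_on_continuous s2 Bx) Bq.
rewrite -(unit_integralD c1 c2); apply: eq_unit_integral => t _.
by rewrite mulrDr.
Qed.

Lemma cubic_averageZ (c : R) T q : smooth_on B T -> B q ->
  cubic_average (fun u => c * T u) q = c * cubic_average T q.
Proof.
move=> s Bq; rewrite /cubic_average /radial_average.
have c1 := continuous01_radial weight_taylor3
  (fun x Bx => smooth_on_continuous s Bx) Bq.
by rewrite -(unit_integralZ c c1); apply: eq_unit_integral => t _; rewrite mulrCA.
Qed.

Lemma eq_cubic_average T1 T2 q : (forall u, B u -> T1 u = T2 u) -> B q ->
  cubic_average T1 q = cubic_average T2 q.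
Proof.
move=> T12 Bq; apply: eq_unit_integral => t t01.
by rewrite T12//; exact: segment_in_ball.
Qed.

Lemma cubic_average_comb T T1 T2 T3 T4 (c1 c2 c3 c4 : R) q :
  smooth_on B T1 -> smooth_on B T2 -> smooth_on B T3 -> smooth_on B T4 ->
  (forall u, B u -> T u = c1 * T1 u + c2 * T2 u + c3 * T3 u + c4 * T4 u) -> B q ->
  cubic_average T q = c1 * cubic_average T1 q + c2 * cubic_average T2 q +
    c3 * cubic_average T3 q + c4 * cubic_average T4 q.
Proof.
move=> s1 s2 s3 s4 TE Bq; rewrite (eq_cubic_average TE Bq).
have oB : open B by exact: open_norm_ball.
have sZ (c : R) T' : smooth_on B T' -> smooth_on B (fun u => c * T' u).
  by move=> sT k; apply: Ck_onM => //; exact: Ck_on_cst.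
have t12 := smooth_onD oB (sZ c1 _ s1) (sZ c2 _ s2).
have t123 := smooth_onD oB t12 (sZ c3 _ s3).
rewrite (cubic_averageD t123 (sZ c4 _ s4) Bq) (cubic_averageD t12 (sZ c3 _ s3) Bq).
by rewrite (cubic_averageD (sZ c1 _ s1) (sZ c2 _ s2) Bq) !cubic_averageZ.
Qed.

(** The third derivative along z = x v + y w is a cubic form in x and y at each point
    of the segment, so its average is a cubic form whose coefficients are smooth
    functions of the end point. *)
Lemma cubic_expansion (phi : 'rV[R]_n -> R) (v w : 'rV[R]_n) (x y : R) :
  smooth_on B phi ->
  let z := x *: v + y *: w in B (z + p) ->
  phi (z + p) = phi p + 'D_z phi p + 2^-1 * derive2 z z phi p +
    (x ^+ 3 * cubic_average (derive3 v v v phi) (z + p) +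
     x ^+ 2 * y * cubic_average (derive3_mixed v w phi) (z + p) +
     x * y ^+ 2 * cubic_average (derive3_mixed w v phi) (z + p) +
     y ^+ 3 * cubic_average (derive3 w w w phi) (z + p)).
Proof.
move=> s z Bz; rewrite (taylor3 s Bz); congr (_ + _).
have oB : open B by exact: open_norm_ball.
have s3 a b c := @smooth_derive3 _ _ B a b c phi s.
have sm a b : smooth_on B (derive3_mixed a b phi).
  by apply: smooth_onD => //; apply: smooth_onD.
have zE u : B u -> derive3 z z z phi u = x ^+ 3 * derive3 v v v phi u +
    x ^+ 2 * y * derive3_mixed v w phi u + x * y ^+ 2 * derive3_mixed w v phi u +
    y ^+ 3 * derive3 w w w phi u by exact: derive3_comb.
exact: (cubic_average_comb (s3 v v v) (sm v w) (sm w v) (s3 w w w) zE Bz).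
Qed.

End taylor_expansion.

(** * A smooth normal form for cubic forms without multiple factor *)

Section row4.
Context {R : realType}.

Definition row4 (a b c d : R) : 'rV[R]_4 := \row_j [:: a; b; c; d]`_j.

Definition entry4 k (Hk : (k < 4)%N) (x : 'rV[R]_4) : R := x 0 (Ordinal Hk).
Notation X0 := (@entry4 0 isT).
Notation X1 := (@entry4 1 isT).
Notation X2 := (@entry4 2 isT).
Notation X3 := (@entry4 3 isT).

Lemma row4E a b c d : (X0 (row4 a b c d) = a) * (X1 (row4 a b c d) = b) *
  (X2 (row4 a b c d) = c) * (X3 (row4 a b c d) = d).
Proof. by rewrite /entry4 !mxE. Qed.

Lemma row4P (x y : 'rV[R]_4) : X0 x = X0 y -> X1 x = X1 y -> X2 x = X2 y ->
  X3 x = X3 y -> x = y.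
Proof.
move=> h0 h1 h2 h3; apply/rowP => -[[|[|[|[|//]]]] Hk];
  by [rewrite (bool_irrelevance Hk isT)].
Qed.

Lemma is_derive_entry4 k (Hk : (k < 4)%N) x v : is_derive x v (entry4 Hk) (entry4 Hk v).
Proof.
apply: DeriveDef; first exact: diff_derivable (differentiable_coord _ _ _).
rewrite (deriveE _ (differentiable_coord _ _ _)).
have cL : continuous (matrix_coord (0 : 'I_1) (Ordinal Hk) : 'rV[R]_4 -> R).
  exact: coord_continuous.
by have -> := @diff_lin _ _ _ (matrix_coord (0 : 'I_1) (Ordinal Hk)) x cL.
Qed.

Lemma smooth_entry4 k (Hk : (k < 4)%N) U j : open U -> Ck_on j U (@entry4 k Hk).
Proof. by move=> oU; apply: Ck_on_coord oU (Ck_on_id j U). Qed.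

(** The coefficients of
    (m0 x + m1 y)^3 + e (m0 x + m1 y) (m2 x + m3 y)^2 as a form in x and y. *)
Definition pullback_coefs (e : R) (m : 'rV[R]_4) : 'rV[R]_4 :=
  row4 (X0 m ^+ 3 + e * (X0 m * X2 m ^+ 2))
    (3 * X0 m ^+ 2 * X1 m + e * (X1 m * X2 m ^+ 2 + 2 * X0 m * X2 m * X3 m))
    (3 * X0 m * X1 m ^+ 2 + e * (X0 m * X3 m ^+ 2 + 2 * X1 m * X2 m * X3 m))
    (X1 m ^+ 3 + e * (X1 m * X3 m ^+ 2)).

End row4.
Local Notation X0 := (@entry4 _ 0 isT).
Local Notation X1 := (@entry4 _ 1 isT).
Local Notation X2 := (@entry4 _ 2 isT).
Local Notation X3 := (@entry4 _ 3 isT).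

Section cubic_section.
Context {R : realType}.

(** In finite dimension an injective differential is invertible. *)
Lemma jacobian_unit n (F : 'rV[R]_n -> 'rV[R]_n) p : differentiable F p ->
  (forall v, 'D_v F p = 0 -> v = 0) -> 'J F p \in unitmx.
Proof.
move=> dF injF; rewrite -row_free_unit -kermx_eq0; apply/rowV0P => v /sub_kermxP.
by rewrite -(deriveEjacobian _ dF); exact: injF.
Qed.

Lemma smooth_pullback_coefs (e : R) : smooth_on setT (pullback_coefs e).
Proof.
move=> k; apply: Ck_on_mx; first exact: openT.
move=> a j; rewrite ord1 {a}.
have cc (c : R) : Ck_on k [set: 'rV[R]_4] (fun=> c) by exact: Ck_on_cst.
have ce i (Hi : (i < 4)%N) : Ck_on k [set: 'rV[R]_4] (@entry4 R i Hi).
  by apply: smooth_entry4; exact: openT.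
have cM (F G : 'rV[R]_4 -> R) : Ck_on k setT F -> Ck_on k setT G ->
  Ck_on k setT (fun x => F x * G x) := Ck_onM openT.
have cD (F G : 'rV[R]_4 -> R) : Ck_on k setT F -> Ck_on k setT G ->
  Ck_on k setT (fun x => F x + G x) := Ck_onD openT.
have cX (F : 'rV[R]_4 -> R) d : Ck_on k setT F -> Ck_on k setT (fun x => F x ^+ d).
  move=> CF; elim: d => [|d IH]; first exact: Ck_on_cst.
  by apply: (Ck_on_eq openT _ (cM _ _ CF IH)) => x _; rewrite exprS.
have e0 := ce 0%N isT; have e1 := ce 1%N isT.
have e2 := ce 2%N isT; have e3 := ce 3%N isT.
have C0 := cD _ _ (cX _ 3%N e0) (cM _ _ (cc e) (cM _ _ e0 (cX _ 2%N e2))).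
have C1 := cD _ _ (cM _ _ (cM _ _ (cc 3%:R) (cX _ 2%N e0)) e1) (cM _ _ (cc e)
  (cD _ _ (cM _ _ e1 (cX _ 2%N e2)) (cM _ _ (cM _ _ (cM _ _ (cc 2%:R) e0) e2) e3))).
have C2 := cD _ _ (cM _ _ (cM _ _ (cc 3%:R) e0) (cX _ 2%N e1)) (cM _ _ (cc e)
  (cD _ _ (cM _ _ e0 (cX _ 2%N e3)) (cM _ _ (cM _ _ (cM _ _ (cc 2%:R) e1) e2) e3))).
have C3 := cD _ _ (cX _ 3%N e1) (cM _ _ (cc e) (cM _ _ e1 (cX _ 2%N e3))).
case: j => -[|[|[|[|//]]]] Hj;
  [move: C0|move: C1|move: C2|move: C3]; apply: (Ck_on_eq openT) => m _;
  by rewrite mxE.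
Qed.

(** At the diagonal matrix (m, n) the differential sends v to
    (3 m^2 v0, 3 m^2 v1 + 2 e m n v2, e (n^2 v0 + 2 m n v3), e n^2 v1):
    the first and the last entry determine v0 and v1, the others v2 and v3. *)
Lemma pullback_coefs_unit (e m n : R) : e != 0 -> m != 0 -> n != 0 ->
  'J (pullback_coefs e) (row4 m 0 0 n) \in unitmx.
Proof.
move=> e0 m0 n0; set x := row4 m 0 0 n.
have dQ : differentiable (pullback_coefs e) x.
  exact: smooth_on_differentiable (smooth_pullback_coefs e) _.
apply: jacobian_unit => // v Dv0.
have d0 := is_derive_entry4 (isT : 0 < 4)%N x v.
have d1 := is_derive_entry4 (isT : 1 < 4)%N x v.
have d2 := is_derive_entry4 (isT : 2 < 4)%N x v.
have d3 := is_derive_entry4 (isT : 3 < 4)%N x v.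
have Dj k (Hk : (k < 4)%N) (F : 'rV[R]_4 -> R) (a : R) : is_derive x v F a ->
    (forall z, entry4 Hk (pullback_coefs e z) = F z) -> a = 0.
  move=> [_ <-] FE; have -> : F = fun z => pullback_coefs e z 0 (Ordinal Hk).
    by apply/funext => z; rewrite -FE.
  by rewrite (derive_coord _ _ _ dQ) Dv0 mxE.
have dM (F G : 'rV[R]_4 -> R) a b : is_derive x v F a -> is_derive x v G b ->
  is_derive x v (fun z => F z * G z) (F x * b + G x * a) by exact: is_deriveM.
have dD (F G : 'rV[R]_4 -> R) a b : is_derive x v F a -> is_derive x v G b ->
  is_derive x v (fun z => F z + G z) (a + b) by exact: is_deriveD.
have dC (c : R) (F : 'rV[R]_4 -> R) a : is_derive x v F a ->
  is_derive x v (fun z => c * F z) (c * a) by exact: is_deriveZ.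
have [x0 x1 x2 x3] : [/\ X0 x = m, X1 x = 0, X2 x = 0 & X3 x = n] by rewrite !row4E.
have E0 : 3 * m ^+ 2 * X0 v = 0.
  have D0 := dD _ _ _ _ (dM _ _ _ _ (dM _ _ _ _ d0 d0) d0)
    (dC e _ _ (dM _ _ _ _ d0 (dM _ _ _ _ d2 d2))).
  rewrite -[RHS](Dj 0%N isT _ _ D0) ?x0 ?x2; first by ring.
  by move=> z; rewrite !row4E; ring.
have E1 : 3 * m ^+ 2 * X1 v + 2 * e * m * n * X2 v = 0.
  have D1 := dD _ _ _ _ (dC 3 _ _ (dM _ _ _ _ (dM _ _ _ _ d0 d0) d1))
    (dC e _ _ (dD _ _ _ _ (dM _ _ _ _ d1 (dM _ _ _ _ d2 d2))
      (dC 2 _ _ (dM _ _ _ _ (dM _ _ _ _ d0 d2) d3)))).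
  rewrite -[RHS](Dj 1%N isT _ _ D1) ?x0 ?x1 ?x2 ?x3; first by ring.
  by move=> z; rewrite !row4E; ring.
have E2 : e * (n ^+ 2 * X0 v + 2 * m * n * X3 v) = 0.
  have D2 := dD _ _ _ _ (dC 3 _ _ (dM _ _ _ _ d0 (dM _ _ _ _ d1 d1)))
    (dC e _ _ (dD _ _ _ _ (dM _ _ _ _ d0 (dM _ _ _ _ d3 d3))
      (dC 2 _ _ (dM _ _ _ _ (dM _ _ _ _ d1 d2) d3)))).
  rewrite -[RHS](Dj 2%N isT _ _ D2) ?x0 ?x1 ?x2 ?x3; first by ring.
  by move=> z; rewrite !row4E; ring.
have E3 : e * n ^+ 2 * X1 v = 0.
  have D3 := dD _ _ _ _ (dM _ _ _ _ (dM _ _ _ _ d1 d1) d1)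
    (dC e _ _ (dM _ _ _ _ d1 (dM _ _ _ _ d3 d3))).
  rewrite -[RHS](Dj 3%N isT _ _ D3) ?x1 ?x3; first by ring.
  by move=> z; rewrite !row4E; ring.
have two0 : 2 != 0 :> R by rewrite pnatr_eq0.
have v0 : X0 v = 0.
  have m2 : 3 * m ^+ 2 != 0 by rewrite mulf_neq0 ?pnatr_eq0 ?expf_neq0.
  by apply: (mulfI m2); rewrite mulr0.
have v1 : X1 v = 0.
  have en2 : e * n ^+ 2 != 0 by rewrite mulf_neq0 ?expf_neq0.
  by apply: (mulfI en2); rewrite mulr0.
have v2 : X2 v = 0.
  have c0 : 2 * e * m * n != 0 by rewrite !mulf_neq0.
  by apply: (mulfI c0); rewrite mulr0 -[RHS]E1 v1; ring.
have v3 : X3 v = 0.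
  have c0 : e * (2 * m * n) != 0 by rewrite !mulf_neq0.
  by apply: (mulfI c0); rewrite mulr0 -[RHS]E2 v0; ring.
by apply: row4P; rewrite ?v0 ?v1 ?v2 ?v3 /entry4 mxE.
Qed.

(** The forms near a x^3 + c x y^2 are pulled back from x^3 + e x y^2 by linear
    maps that depend smoothly on them: the orbit map is a local diffeomorphism
    by [pullback_coefs_unit], so its local inverse does it. *)
Lemma cubic_normal_form_section (e m n : R) : e != 0 -> m != 0 -> n != 0 ->
  exists (W : set 'rV[R]_4) (M : 'rV[R]_4 -> 'rV[R]_4),
    [/\ open W, W (row4 (m ^+ 3) 0 (e * m * n ^+ 2) 0), smooth_on W M,
      M (row4 (m ^+ 3) 0 (e * m * n ^+ 2) 0) = row4 m 0 0 n
    & forall y, W y -> pullback_coefs e (M y) = y].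
Proof.
move=> e0 m0 n0; have uJ := pullback_coefs_unit e0 m0 n0.
have [U [W [M [[oU Ux _] oW sM UM WM]]]] :=
  inverse_function openT (I : [set: 'rV[R]_4] _) (smooth_pullback_coefs e) uJ.
have QE : pullback_coefs e (row4 m 0 0 n) = row4 (m ^+ 3) 0 (e * m * n ^+ 2) 0.
  by rewrite /pullback_coefs !row4E; congr row4; ring.
have [Wx Mx] := UM _ Ux; rewrite QE in Wx Mx.
by exists W, M; split=> // y /WM[].
Qed.

End cubic_section.

(** * Cubic forms with smooth coefficients *)

Section D4_sufficiency.
Context {R : realType}.

Lemma cube_root (a : R) : a != 0 -> exists2 m : R, m != 0 & m ^+ 3 = a.
Proof.
have pos (b : R) : 0 < b -> exists2 m : R, m != 0 & m ^+ 3 = b.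
  move=> b0; exists (b `^ 3^-1); first by rewrite gt_eqF// powR_gt0.
  by rewrite -powR_mulrn ?powR_ge0// -powRrM mulVf ?pnatr_eq0// powRr1// ltW.
rewrite neq_lt => /orP[a0|]; last exact: pos.
have [|m m0 mE] := pos (- a); first by rewrite oppr_gt0.
by exists (- m); rewrite ?oppr_eq0// exprNn mE -signr_odd/= mulN1r opprK.
Qed.

Lemma row2P (x y : 'rV[R]_2) : x 0 0 = y 0 0 -> x 0 1 = y 0 1 -> x = y.
Proof.
move=> h0 h1; apply/rowP => -[[|[|//]] Hk].
  by have -> : Ordinal Hk = 0 by exact: val_inj.
by have -> : Ordinal Hk = 1 by exact: val_inj.
Qed.

Definition row2 (a b : R) : 'rV[R]_2 := \row_j [:: a; b]`_j.

Lemma row2E a b : (row2 a b 0 0 = a) * (row2 a b 0 1 = b).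
Proof. by rewrite !mxE. Qed.

(** Only the derivatives of the factors that vanish at p contribute. *)
Lemma is_derive_sum_products (V : normedModType R) (F G H K : V -> R) p u dG dK :
  differentiable F p -> differentiable H p -> G p = 0 -> K p = 0 ->
  is_derive p u G dG -> is_derive p u K dK ->
  is_derive p u (fun q => F q * G q + H q * K q) (F p * dG + H p * dK).
Proof.
move=> dF dH G0 K0 iG iK.
have iF : is_derive p u F ('D_u F p) by apply: derivableP; exact: diff_derivable.
have iH : is_derive p u H ('D_u H p) by apply: derivableP; exact: diff_derivable.
apply: (is_derive_eq (is_deriveD (is_deriveM iF iG) (is_deriveM iH iK))).
by rewrite G0 K0 !scale0r !addr0.
Qed.

(** Both normal forms at once: e = 1 is [D4_plus] and e = -1 is [D4_minus]. *)
Definition D4_form (e : R) (x : 'rV[R]_2) : R :=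
  x 0 0 ^+ 3 + e * (x 0 0 * x 0 1 ^+ 2).

Lemma pullback_coefsE (e : R) m x y :
  let N := pullback_coefs e m in
  x ^+ 3 * X0 N + x ^+ 2 * y * X1 N + x * y ^+ 2 * X2 N + y ^+ 3 * X3 N =
  D4_form e (row2 (X0 m * x + X1 m * y) (X2 m * x + X3 m * y)).
Proof. by rewrite /= !row4E /D4_form !row2E; ring. Qed.

Variables (p : 'rV[R]_2) (r : R) (r0 : 0 < r).
Let B := [set x : 'rV[R]_2 | `|x - p| < r].

(** The coefficients A1, ..., A4 at q form a cubic form close to the one at p, so
    it is the pullback of the normal form by a matrix N(q) smooth in q; the change of
    coordinates is q |-> N(q) z, whose differential at p is u |-> N(p) (u P) because
    z vanishes there. *)
Theorem D4_of_cubic_form (phi A1 A2 A3 A4 : 'rV[R]_2 -> R) (P : 'M[R]_2) :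
  P \in unitmx ->
  smooth_on B A1 -> smooth_on B A2 -> smooth_on B A3 -> smooth_on B A4 ->
  A1 p != 0 -> A2 p = 0 -> A3 p != 0 -> A4 p = 0 ->
  (forall q, B q -> let z := (q - p) *m P in
    phi q = z 0 0 ^+ 3 * A1 q + z 0 0 ^+ 2 * z 0 1 * A2 q +
            z 0 0 * z 0 1 ^+ 2 * A3 q + z 0 1 ^+ 3 * A4 q) ->
  D4_singularity phi p.
Proof.
move=> uP s1 s2 s3 s4 a0 b0 c0 d0 phiE.
have oB : open B by exact: open_norm_ball.
have Bp : B p by rewrite /B/= subrr normr0.
have [m m0 mE] := cube_root a0.
(* A1 p = m^3 and A3 p = e m n^2, so the form at p is the pullback of the normal
   form by the diagonal matrix (m, n) *)
pose n := Num.sqrt `|A3 p / m|; pose e := Num.sg (A3 p / m).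
have cm0 : A3 p / m != 0 by rewrite mulf_neq0// invr_neq0.
have n0 : n != 0 by rewrite gt_eqF// sqrtr_gt0 normr_gt0.
have e0 : e != 0 by rewrite sgr_eq0.
have cE : e * m * n ^+ 2 = A3 p.
  by rewrite sqr_sqrtr// mulrAC -numEsg divfK.
suff : R_equivalent phi p (D4_form e) 0.
  have [ep|en|e0'] := ltrgt0P (A3 p / m).
  - left; suff <- : D4_form e = @D4_plus R by [].
    by apply/funext => x; rewrite /D4_form /D4_plus /e gtr0_sg// mul1r.
  - right; suff <- : D4_form e = @D4_minus R by [].
    by apply/funext => x; rewrite /D4_form /D4_minus /e ltr0_sg// mulN1r.
  - by rewrite e0' eqxx in cm0.
have [W [M [oW Wx sM Mx QM]]] := cubic_normal_form_section e0 m0 n0.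
pose F4 q := row4 (A1 q) (A2 q) (A3 q) (A4 q).
have C4 k : Ck_on k B F4.
  apply: (Ck_on_mx oB) => i j.
  case: j => -[|[|[|[|//]]]] Hj;
  [move: (s1 k)|move: (s2 k)|move: (s3 k)|move: (s4 k)]; apply: (Ck_on_eq oB) => q _;
  by rewrite mxE.
have F4p : F4 p = row4 (m ^+ 3) 0 (e * m * n ^+ 2) 0.
  by rewrite /F4 mE cE b0 d0.
pose U := [set q | B q /\ W (F4 q)].
have oU : open U by exact: open_preimage_on oB (C4 0%N) oW.
have Up : U p by split; rewrite ?F4p.
have UB : U `<=` B by move=> q [].
pose N q := M (F4 q).
have CN k : Ck_on k U N.
  have CF : Ck_on k U F4 by exact: Ck_on_sub (C4 k).
  by apply: (Ck_on_comp_mx oU oW _ CF (sM k)) => q [].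
have CNk i (Hi : (i < 4)%N) k : Ck_on k U (fun q => entry4 Hi (N q)).
  exact: (Ck_on_coord _ _ oU (CN k)).
have dN i (Hi : (i < 4)%N) : differentiable (fun q => entry4 Hi (N q)) p.
  exact: (CNk i Hi 1%N).1.
have Np : N p = row4 m 0 0 n by rewrite /N F4p.
have [L LE] := mulmxr_linear P.
pose z (j : 'I_2) q : R := (L (q - p)) 0 j.
have dz0 q : differentiable (fun q => q - p) q.
  by apply: differentiableB; [exact: ex_diff|exact: differentiable_cst].
have Cz j k : Ck_on k U (z j).
  apply: (Ck_on_coord _ _ oU).
  apply: (Ck_on_lin oU (@linear_continuous_rV _ _ _ L)).
  exact: (Ck_onD oU (Ck_on_id k U) (Ck_on_cst k U (- p))).
have zp j : z j p = 0 by rewrite /z subrr linear0 mxE.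
have dz j u : is_derive p u (z j) ((u *m P) 0 j).
  apply: DeriveDef; first exact: diff_derivable ((Cz j 1%N).1 p Up).
  have cL := @linear_continuous_rV _ _ _ L.
  rewrite /z (derive_coord _ _ _ (differentiable_lin cL (dz0 p))).
  rewrite (derive_lin _ cL (dz0 p)) LE.
  congr ((_ *m _) _ _).
  have -> : (fun q : 'rV[R]_2 => q - p) = id - cst p by [].
  rewrite (deriveB (@derivable_id _ _ p u) (@derivable_cst _ _ _ p p u)).
  by rewrite derive_id derive_cst subr0.
pose psi q := row2 (X0 (N q) * z 0 q + X1 (N q) * z 1 q)
  (X2 (N q) * z 0 q + X3 (N q) * z 1 q).
have Cpsi k : Ck_on k U psi.
  have C0 := Ck_onD oU (Ck_onM oU (CNk 0%N isT k) (Cz 0 k))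
    (Ck_onM oU (CNk 1%N isT k) (Cz 1 k)).
  have C1 := Ck_onD oU (Ck_onM oU (CNk 2%N isT k) (Cz 0 k))
    (Ck_onM oU (CNk 3%N isT k) (Cz 1 k)).
  apply: (Ck_on_mx oU) => i j.
  case: j => -[|[|//]] Hj; [move: C0|move: C1]; apply: (Ck_on_eq oU) => q _;
  by rewrite mxE.
have dpsi : differentiable psi p by exact: (Cpsi 1%N).1.
have psip : psi p = 0.
  by apply: row2P; rewrite row2E !zp !mulr0 addr0 mxE.
have Jpsi : 'J psi p \in unitmx.
  apply: jacobian_unit => // u Du.
  have D0 := is_derive_sum_products (dN 0%N isT) (dN 1%N isT) (zp 0) (zp 1)
    (dz 0 u) (dz 1 u).
  have D1 := is_derive_sum_products (dN 2%N isT) (dN 3%N isT) (zp 0) (zp 1)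
    (dz 0 u) (dz 1 u).
  have E0 : m * (u *m P) 0 0 = 0.
    have := derive_coord 0 0 u dpsi; rewrite Du mxE.
    have -> : (fun q => psi q 0 0) = fun q => X0 (N q) * z 0 q + X1 (N q) * z 1 q.
      by apply/funext => q; rewrite row2E.
    by case: D0 => _ ->; rewrite Np !row4E mul0r addr0.
  have E1 : n * (u *m P) 0 1 = 0.
    have := derive_coord 0 1 u dpsi; rewrite Du mxE.
    have -> : (fun q => psi q 0 1) = fun q => X2 (N q) * z 0 q + X3 (N q) * z 1 q.
      by apply/funext => q; rewrite row2E.
    by case: D1 => _ ->; rewrite Np !row4E mul0r add0r.
  have uP0 : u *m P = 0.
    apply: row2P; rewrite [RHS]mxE.
      by apply: (mulfI m0); rewrite mulr0.
    by apply: (mulfI n0); rewrite mulr0.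
  by rewrite -[u](mulmxK uP) uP0 mul0mx.
have [U' [W' [chi [[oU' U'p U'U] oW' schi UW WU]]]] := inverse_function oU Up Cpsi Jpsi.
exists psi.
  exists U', W', chi; split; [by []|by []| |by []|by []].
  by split=> // k; exact: Ck_on_sub U'U (Cpsi k).
have nU : nbhs p U by exact: open_nbhs_nbhs.
apply: (@filterS _ _ (nbhs_filter p) _ _ _ nU) => q Uq.
have := pullback_coefsE e (N q) (z 0 q) (z 1 q).
have [Bq Wq] := Uq.
rewrite /= (QM _ Wq) !row4E => E; apply: etrans _ E.
rewrite /z LE; exact: phiE.
Qed.

End D4_sufficiency.

(** * The 3-jet of a D4 singularity *)

Lemma continuous_comp_eq (T U V : topologicalType) (f : T -> U) (g : U -> V) x y :
  f x = y -> {for x, continuous f} -> {for y, continuous g} ->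
  {for x, continuous (g \o f)}.
Proof. by move=> <-; exact: continuous_comp. Qed.

Lemma continuous_dnbhs (T U : topologicalType) (f : T -> U) x :
  {for x, continuous f} -> f @ x^' --> f x.
Proof. by move=> cf; apply: cvg_trans cf; apply: cvg_app; exact: cvg_within. Qed.

Lemma cvg_near_unique (R : realType) (T : Type) (F : set_system T)
    {PF : ProperFilter F} (f g : T -> R) (a b : R) :
  (\forall t \near F, f t = g t) -> f @ F --> a -> g @ F --> b -> a = b.
Proof.
move=> fg fa gb; have ga : g @ F --> a.
  by apply: cvg_trans fa; apply: near_eq_cvg; apply: filterS fg => t ->.
exact: (cvg_unique _ ga gb).
Qed.

Section D4_necessity.
Context {R : realType}.

Lemma D4_formZ (e t : R) x : D4_form e (t *: x) = t ^+ 3 * D4_form e x.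
Proof. by rewrite /D4_form !mxE; ring. Qed.

Lemma D4_singularity_form (phi : 'rV[R]_2 -> R) p : D4_singularity phi p ->
  exists2 e : R, e != 0 & R_equivalent phi p (D4_form e) 0.
Proof.
case=> H; [exists 1|exists (-1)]; rewrite ?oner_eq0 ?oppr_eq0 ?oner_eq0//.
- suff -> : D4_form 1 = @D4_plus R by [].
  by apply/funext => x; rewrite /D4_form mul1r.
- suff -> : D4_form (-1) = @D4_minus R by [].
  by apply/funext => x; rewrite /D4_form mulN1r.
Qed.

(** The chain rule for chi \o psi = id. *)
Lemma diffeo_germ_diff_inj (a b : 'rV[R]_2) psi : diffeo_germ a b psi ->
  differentiable psi a /\ forall v, 'd psi a v = 0 -> v = 0.
Proof.
move=> [U [W [chi [[oU oW] [Ua psia] [spsi schi] UW _]]]].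
have dpsi := smooth_on_differentiable spsi Ua.
have [Wa _] := UW a Ua; have dchi := smooth_on_differentiable schi Wa.
split=> // v v0.
have dcomp : differentiable (chi \o psi) a by exact: differentiable_comp.
have e1 : 'D_v (chi \o psi) a = v.
  apply: etrans _ (derive_id a v).
  by apply: near_eq_derive; apply: (open_near_eq oU _ Ua) => x /UW[].
have e2 : 'D_v (chi \o psi) a = 0.
  apply: etrans (deriveE _ dcomp) _.
  apply: etrans (congr1 (fun F : 'rV[R]_2 -> 'rV[R]_2 => F v) (diff_comp dpsi dchi)) _.
  apply: etrans (congr1 ('d chi (psi a)) v0) _.
  exact: linear0.
exact: etrans (esym e1) e2.
Qed.

Lemma cvg_D4_form (e : R) (F : set_system R) {FF : ProperFilter F}
    (u : R -> 'rV[R]_2) (l : 'rV[R]_2) :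
  u @ F --> l -> (fun t => D4_form e (u t)) @ F --> D4_form e l.
Proof.
move=> ul.
have c j : (fun t => u t 0 j) @ F --> l 0 j.
  apply: (@cvg_comp _ _ _ u (fun x : 'rV[R]_2 => x 0 j) F (nbhs l) (nbhs (l 0 j)) ul).
  exact: coord_continuous.
rewrite /D4_form.
have c0 := c 0; have c1 := c 1.
have c2 : (fun t => u t 0 0 ^+ 3 + e * (u t 0 0 * u t 0 1 ^+ 2)) =
    fun t => u t 0 0 * (u t 0 0 * u t 0 0) + e * (u t 0 0 * (u t 0 1 * u t 0 1)).
  by apply/funext => t; ring.
have -> : l 0 0 ^+ 3 + e * (l 0 0 * l 0 1 ^+ 2) =
  l 0 0 * (l 0 0 * l 0 0) + e * (l 0 0 * (l 0 1 * l 0 1)) by ring.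
rewrite c2; apply: cvgD; first by apply: cvgM => //; exact: cvgM.
apply: cvgM; first exact: cvg_cst.
by apply: cvgM => //; exact: cvgM.
Qed.

Variables (p : 'rV[R]_2) (r : R).
Hypothesis r0 : 0 < r.
Let B := [set x : 'rV[R]_2 | `|x - p| < r].

(** The form is homogeneous of degree 3, so that phi (t z + p) is t^3 times its value
    at (psi (t z + p) - psi p) / t. Comparison with Taylor's formula and t tending to 0
    determine the terms of degree 2, then 3. *)
Lemma D4_form_jet (phi : 'rV[R]_2 -> R) (e : R) psi :
  smooth_on B phi -> phi p = 0 -> (forall z : 'rV[R]_2, 'D_z phi p = 0) ->
  diffeo_germ p 0 psi -> (\forall q \near p, phi q = D4_form e (psi q)) ->
  forall z : 'rV[R]_2, derive2 z z phi p = 0 /\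
    6^-1 * derive3 z z z phi p = D4_form e ('d psi p z).
Proof.
move=> sphi phi0 dphi0 gpsi phiE z.
have [dpsi _] := diffeo_germ_diff_inj gpsi.
have psip : psi p = 0 by case: gpsi => [U [W [chi [_ [_ ->]]]]].
have Bp : B p by rewrite /B/= subrr normr0.
have oB : open B by exact: open_norm_ball.
pose line (t : R) := t *: z + p.
have cline : {for 0, continuous line}.
  apply: differentiable_continuous; apply: differentiableD.
    by apply: differentiableZl; exact: ex_diff.
  exact: differentiable_cst.
have line0 : line 0 = p by rewrite /line scale0r add0r.
pose K (t : R) := cubic_average p (derive3 z z z phi) (line t).
have cK : K @ 0^' --> K 0.
  have cA : {for p, continuous (cubic_average p (derive3 z z z phi))}.
    apply: smooth_on_continuous Bp; apply: smooth_cubic_average.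
    exact: smooth_derive3.
  by apply: continuous_dnbhs; exact: (continuous_comp_eq line0 cline cA).
pose delta (t : R) := t^-1 *: (psi (line t) - psi p).
have cdelta : delta @ 0^' --> 'd psi p z.
  have := @diff_derivable _ _ _ _ _ z dpsi.
  by rewrite /derivable -(deriveE _ dpsi).
have cg : (fun t => D4_form e (delta t)) @ 0^' --> D4_form e ('d psi p z).
  exact: cvg_D4_form cdelta.
pose h : R := derive2 z z phi p.
have nearE : \forall t \near (0 : R)^', 2^-1 * h = t * (D4_form e (delta t) - K t).
  have n1 : nbhs p (B `&` [set q | phi q = D4_form e (psi q)]).
    by apply: filterI; [exact: open_nbhs_nbhs|exact: phiE].
  have n2 : \forall t \near (0 : R), (B `&` [set q | phi q = D4_form e (psi q)]) (line t).
    by apply: cline; rewrite line0.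
  near=> t.
  have t0 : t != 0 by near: t; exact: nbhs_dnbhs_neq.
  have [Bt phit] : (B `&` [set q | phi q = D4_form e (psi q)]) (line t).
    by near: t; exact: nbhs_dnbhs n2.
  have Et : t *: z + 0 *: (0 : 'rV[R]_2) = t *: z by rewrite scale0r addr0.
  have E : phi (line t) = 2^-1 * (t ^+ 2 * h) + t ^+ 3 * K t.
    have Bt' : B (t *: z + 0 *: (0 : 'rV[R]_2) + p) by rewrite Et.
    have := cubic_expansion sphi Bt'; rewrite (derive2_comb _ _ _ _ oB sphi Bp).
    rewrite Et phi0 dphi0 expr0n/= mulr0 !mul0r !addr0 add0r.
    by rewrite expr0n/= mulr0 !mul0r !addr0.
  have gE : D4_form e (psi (line t)) = t ^+ 3 * D4_form e (delta t).
    have -> : psi (line t) = t *: delta t.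
      by rewrite /delta psip subr0 scalerA mulfV// scale1r.
    exact: D4_formZ.
  have t20 : t ^+ 2 != 0 by rewrite expf_neq0.
  apply: (mulfI t20).
  have alg (g k h' : R) : 2^-1 * (t ^+ 2 * h') + t ^+ 3 * k = t ^+ 3 * g ->
      t ^+ 2 * (2^-1 * h') = t ^+ 2 * (t * (g - k)).
    move=> E'; apply: (addIr (t ^+ 3 * k)); rewrite mulrCA E'; ring.
  exact: alg (etrans (esym E) (etrans phit gE)).
have c0 : (fun t : R => t) @ 0^' --> (0 : R).
  exact: cvg_within.
have cprod : (fun t => t * (D4_form e (delta t) - K t)) @ 0^' -->
    0 * (D4_form e ('d psi p z) - K 0).
  by apply: cvgM => //; apply: cvgB.
have ch : (fun=> 2^-1 * h) @ (0 : R)^' --> 2^-1 * h by exact: cvg_cst.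
have h0 : h = 0.
  have E0 : 2^-1 * h = 0 by rewrite (cvg_near_unique nearE ch cprod) mul0r.
  have i2 : 2^-1 != 0 :> R by rewrite invr_eq0 pnatr_eq0.
  by apply: (mulfI i2); rewrite mulr0.
split; first exact: h0.
have K0 : K 0 = 6^-1 * derive3 z z z phi p by rewrite /K line0 cubic_average_center.
apply: etrans (esym K0) _; apply: (cvg_near_unique _ cK cg).
near=> t.
have t0 : t != 0 by near: t; exact: nbhs_dnbhs_neq.
have : 2^-1 * h = t * (D4_form e (delta t) - K t) by near: t; exact: nearE.
rewrite h0 mulr0 -(mulr0 t) => /(mulfI t0)/esym/eqP.
by rewrite subr_eq0 => /eqP ->.
Unshelve. all: by end_near. Qed.

End D4_necessity.

(** * A criterion for D4 singularities *)

Section D4_criterion.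
Context {R : realType}.

(** The form x y^2 is singular along y = 0, hence so is the normal form at v in the
    directions v and w. Since the normal form is singular at the origin only, the
    plane map (x, y) |-> x v + y w is not injective. *)
Lemma degenerate_pullback (e c : R) (v w : 'rV[R]_2) : e != 0 ->
  (forall x y : R, D4_form e (x *: v + y *: w) = c * (x * y ^+ 2)) ->
  v 0 0 * w 0 1 - v 0 1 * w 0 0 = 0.
Proof.
move=> e0 H; move: (H 1 0) (H 1 1) (H 1 (-1)) (H 1 2); rewrite /D4_form !mxE.
(* E0 and E1 below are the coefficients of x^3 and x^2 y; four values at x = 1
   determine them *)
move: (v 0 0) (v 0 1) (w 0 0) (w 0 1) => a b g d H0 H1 H2 H3.
have E0 : a * (a ^+ 2 + e * b ^+ 2) = 0 by rewrite -[RHS](mulr0 c); lra.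
have E1 : 3 * a ^+ 2 * g + e * (b ^+ 2 * g + 2 * a * b * d) = 0 by lra.
have [a0|an0] := eqVneq a 0.
  have : b * (b * g) = 0.
    apply: (mulfI e0); rewrite mulr0 -[RHS]E1 a0; ring.
  by move/eqP; rewrite a0 mulf_eq0 => /orP[/eqP->|/eqP->]; rewrite ?mul0r ?subrr.
have E0' : a ^+ 2 + e * b ^+ 2 = 0 by apply: (mulfI an0); rewrite mulr0.
have two0 : 2 * a != 0 by rewrite mulf_neq0// pnatr_eq0.
have E2 : a * g + e * (b * d) = 0.
  apply: (mulfI two0); rewrite mulr0 -[RHS]E1.
  have -> : e * (b ^+ 2 * g + 2 * a * b * d) = e * b ^+ 2 * g + 2 * a * (e * (b * d)).
    by ring.
  have -> : e * b ^+ 2 = - a ^+ 2 by apply/eqP; rewrite -addr_eq0 addrC E0'.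
  by ring.
apply: (mulfI an0); rewrite mulr0.
have -> : a * (a * d - b * g) = (a ^+ 2 + e * b ^+ 2) * d - b * (a * g + e * (b * d)).
  by ring.
by rewrite E0' E2 mul0r mulr0 subrr.
Qed.

Definition frame (v w : 'rV[R]_2) : 'M[R]_2 :=
  \matrix_(i, j) (if i == 0 then v 0 j else w 0 j).

Lemma mul_frame (z v w : 'rV[R]_2) : z *m frame v w = z 0 0 *: v + z 0 1 *: w.
Proof.
apply/rowP => j; rewrite !mxE big_ord_recl big_ord1 !mxE /=.
by congr (_ * _ + z 0 _ * _); exact: val_inj.
Qed.

Lemma frame_unit (v w : 'rV[R]_2) :
  (forall x y : R, x *: v + y *: w = 0 -> x = 0 /\ y = 0) -> frame v w \in unitmx.
Proof.
move=> H; rewrite -row_free_unit -kermx_eq0; apply/rowV0P => z /sub_kermxP.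
by rewrite mul_frame => /H[z0 z1]; apply: row2P; rewrite ?z0 ?z1 mxE.
Qed.

Lemma linear_independent_det (f : {linear 'rV[R]_2 -> 'rV[R]_2}) (v w : 'rV[R]_2) :
  (forall u, f u = 0 -> u = 0) ->
  (forall x y : R, x *: v + y *: w = 0 -> x = 0 /\ y = 0) ->
  f v 0 0 * f w 0 1 - f v 0 1 * f w 0 0 != 0.
Proof.
move=> injf vw; apply/eqP => D.
have comb x y : x *: f v + y *: f w = 0 -> x = 0 /\ y = 0.
  by rewrite -!linearZ -linearD => /injf/vw.
have [w0 v0] : f w 0 0 = 0 /\ - f v 0 0 = 0.
  apply: comb; apply: row2P; rewrite !mxE; first by ring.
  by rewrite -[RHS](oppr0) -D; ring.
have [w1 v1] : f w 0 1 = 0 /\ - f v 0 1 = 0.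
  apply: comb; apply: row2P; rewrite !mxE; last by ring.
  by rewrite -[RHS]D; ring.
have [|_ /eqP] := comb 0 1; last by rewrite oner_eq0.
by rewrite scale0r scale1r add0r; apply: row2P; rewrite ?w0 ?w1 mxE.
Qed.

Variables (p : 'rV[R]_2) (r : R).
Hypothesis r0 : 0 < r.
Let B := [set x : 'rV[R]_2 | `|x - p| < r].

(** Once the Hessian vanishes, the cubic form of [phi] at [p] in the frame (v, w) is
    a x^3 + 3 b x y^2 with b nonzero: it has no multiple linear factor if and only if
    a is nonzero. *)
Theorem D4_criterion (phi : 'rV[R]_2 -> R) (v w : 'rV[R]_2) :
  smooth_on B phi -> phi p = 0 -> (forall z : 'rV[R]_2, 'D_z phi p = 0) ->
  (forall x y : R, x *: v + y *: w = 0 -> x = 0 /\ y = 0) ->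
  derive2 v w phi p = 0 -> derive2 w v phi p = 0 -> derive2 w w phi p = 0 ->
  (derive2 v v phi p = 0 -> [/\ derive3_mixed v w phi p = 0,
    derive3_mixed w v phi p != 0 & derive3 w w w phi p = 0]) ->
  D4_singularity phi p <->
  derive2 v v phi p = 0 /\ derive3 v v v phi p != 0.
Proof.
move=> sphi phi0 dphi0 vw hvw hwv hww jet3.
have oB : open B by exact: open_norm_ball.
have Bp : B p by rewrite /B/= subrr normr0.
have six0 : 6^-1 != 0 :> R by rewrite invr_eq0 pnatr_eq0.
split=> [|[hvv avvv]].
  move=> /D4_singularity_form[e e0 [psi gpsi phiE]].
  have jet := D4_form_jet r0 sphi phi0 dphi0 gpsi phiE.
  have [hvv _] := jet v; split=> //; apply/eqP => avvv.
  have [m1 m2 m3] := jet3 hvv.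
  have [_ injL] := diffeo_germ_diff_inj gpsi.
  have := linear_independent_det injL vw.
  rewrite (@degenerate_pullback e (6^-1 * derive3_mixed w v phi p)) ?eqxx// => x y.
  rewrite -!linearZ -linearD; have [_ <-] := jet (x *: v + y *: w).
  rewrite (derive3_comb _ _ _ _ oB sphi Bp) avvv m1 m3.
  by rewrite !mulr0 !add0r addr0; ring.
have [m1 m2 m3] := jet3 hvv.
have uF := frame_unit vw.
have s3 a b c := @smooth_derive3 _ _ B a b c phi sphi.
have sm a b : smooth_on B (derive3_mixed a b phi).
  by apply: smooth_onD => //; apply: smooth_onD.
have uP : invmx (frame v w) \in unitmx by rewrite unitmx_inv.
apply: (D4_of_cubic_form r0 uP (smooth_cubic_average (s3 v v v))
  (smooth_cubic_average (sm v w)) (smooth_cubic_average (sm w v))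
  (smooth_cubic_average (s3 w w w))); rewrite ?cubic_average_center.
- by rewrite mulf_neq0.
- by rewrite m1 mulr0.
- by rewrite mulf_neq0.
- by rewrite m3 mulr0.
move=> q Bq z.
have zE : z 0 0 *: v + z 0 1 *: w = q - p by rewrite -mul_frame mulmxKV.
have Bz : B (z 0 0 *: v + z 0 1 *: w + p) by rewrite zE subrK.
have := cubic_expansion sphi Bz; rewrite (derive2_comb _ _ _ _ oB sphi Bp).
rewrite zE subrK phi0 dphi0 hvv hvw hwv hww => ->.
by rewrite !(addr0, mulr0, add0r).
Qed.

End D4_criterion.

(** * Scalar products, derivatives along curves and triple products *)

Section dot_product.
Context {R : realType}.
Implicit Types V : normedModType R.

Lemma dotvC n (x y : 'rV[R]_n) : dotv x y = dotv y x.
Proof. by apply: eq_bigr => i _; rewrite mulrC. Qed.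

Lemma dotvDl n (x y z : 'rV[R]_n) : dotv (x + y) z = dotv x z + dotv y z.
Proof. by rewrite -big_split; apply: eq_bigr => i _; rewrite mxE mulrDl. Qed.

Lemma dotvZl n (a : R) (x y : 'rV[R]_n) : dotv (a *: x) y = a * dotv x y.
Proof. by rewrite mulr_sumr; apply: eq_bigr => i _; rewrite mxE mulrA. Qed.

Lemma dotv0l n (x : 'rV[R]_n) : dotv 0 x = 0.
Proof. by rewrite -(scale0r 0) dotvZl mul0r. Qed.

Lemma dotv0r n (x : 'rV[R]_n) : dotv x 0 = 0.
Proof. by rewrite dotvC dotv0l. Qed.

Lemma dotvZr n (a : R) (x y : 'rV[R]_n) : dotv x (a *: y) = a * dotv x y.
Proof. by rewrite dotvC dotvZl dotvC. Qed.

Lemma dotvv_eq0 n (x : 'rV[R]_n) : dotv x x = 0 -> x = 0.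
Proof.
move=> /eqP; rewrite psumr_eq0; last by move=> i _; rewrite -expr2 sqr_ge0.
move=> /allP H; apply/rowP => i; rewrite mxE; apply/eqP.
by have := H i (mem_index_enum i); rewrite /= mulf_eq0 orbb.
Qed.

Lemma Ck_on_dot V n k (U : set V) (F G : V -> 'rV[R]_n) : open U ->
  Ck_on k U F -> Ck_on k U G -> Ck_on k U (fun q => dotv (F q) (G q)).
Proof.
move=> oU CF CG.
apply: (@Ck_on_sum R V R k U _ _ _ (fun i q => F q 0 i * G q 0 i) oU) => i _.
by apply: (Ck_onM oU); apply: (Ck_on_coord _ _ oU).
Qed.

Lemma is_derive_dot V n (F G : V -> 'rV[R]_n) x a :
  differentiable F x -> differentiable G x ->
  is_derive x a (fun q => dotv (F q) (G q))
    (dotv ('D_a F x) (G x) + dotv (F x) ('D_a G x)).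
Proof.
move=> dF dG.
have dc (H : V -> 'rV[R]_n) i : differentiable H x ->
    is_derive x a (fun q => H q 0 i) ('D_a H x 0 i).
  move=> dH; rewrite -(derive_coord _ _ _ dH); apply: derivableP.
  apply: diff_derivable.
  exact: (differentiable_comp dH (differentiable_coord (H x) 0 i)).
have dp i : is_derive x a ((fun q => F q 0 i) * (fun q => G q 0 i))
    (F x 0 i * 'D_a G x 0 i + G x 0 i * 'D_a F x 0 i).
  exact: is_deriveM (dc F i dF) (dc G i dG).
have -> : (fun q => dotv (F q) (G q)) =
    \sum_(i < n) ((fun q => F q 0 i) * (fun q => G q 0 i)).
  by apply/funext => q; rewrite /dotv fct_sumE.
apply: (is_derive_eq (is_derive_sum _)).
rewrite /dotv -big_split; apply: eq_bigr => i _ /=.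
by rewrite addrC; congr (_ + _); exact: mulrC.
Qed.

Lemma derive_dot V n (F G : V -> 'rV[R]_n) x a :
  differentiable F x -> differentiable G x ->
  'D_a (fun q => dotv (F q) (G q)) x =
    dotv ('D_a F x) (G x) + dotv (F x) ('D_a G x).
Proof. by move=> dF dG; case: (is_derive_dot a dF dG). Qed.

Lemma dotv_linear n (c : 'rV[R]_n) :
  exists L : {linear 'rV[R]_n -> R}, forall x, L x = dotv x c.
Proof.
have lin : linear (fun x => dotv x c).
  by move=> a x y; rewrite dotvDl dotvZl.
pose LM := GRing.isLinear.Build R 'rV[R]_n R *%R (fun x => dotv x c) lin.
pose L : {linear 'rV[R]_n -> R} := HB.pack (fun x => dotv x c) LM.
by exists L.
Qed.

Lemma derive_dot_cst V n (F : V -> 'rV[R]_n) c x a : differentiable F x ->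
  'D_a (fun q => dotv (F q) c) x = dotv ('D_a F x) c.
Proof.
move=> dF; have [L LE] := dotv_linear c.
have -> : (fun q => dotv (F q) c) = fun q => L (F q) by apply/funext => q; rewrite LE.
by rewrite (derive_lin _ (@linear_continuous_rV _ _ _ L) dF) LE.
Qed.

Lemma Ck_on_dot_cst V n k (U : set V) (F : V -> 'rV[R]_n) c : open U ->
  Ck_on k U F -> Ck_on k U (fun q => dotv (F q) c).
Proof. by move=> oU CF; apply: Ck_on_dot => //; exact: Ck_on_cst. Qed.

Lemma dotv_derive_comb V n (F : V -> 'rV[R]_n)
    v w (x y : R) c q : differentiable F q ->
  dotv ('D_(x *: v + y *: w) F q) c = x * dotv ('D_v F q) c + y * dotv ('D_w F q) c.
Proof.
move=> dF; have DE := etrans (deriveDv (x *: v) (y *: w) dF)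
  (congr2 +%R (deriveZv x v dF) (deriveZv y w dF)).
apply: etrans (congr1 (fun d => dotv d c) DE) _.
exact: etrans (dotvDl _ _ _) (congr2 +%R (dotvZl _ _ _) (dotvZl _ _ _)).
Qed.

End dot_product.

Section derive_along_curve.
Context {R : realType} {T : normedModType R} {n : nat}.

(** The product rule for the scalar product of eta with the gradient of g along gamma;
    the last term freezes eta at its value at t0. *)
Lemma derive_along_curve (U : set 'rV[R]_n) (g : 'rV[R]_n -> R)
    (gamma eta : T -> 'rV[R]_n) t0 a :
  open U -> smooth_on U g -> U (gamma t0) ->
  differentiable gamma t0 -> differentiable eta t0 ->
  differentiable (fun t => 'D_(eta t) g (gamma t)) t0 /\
  'D_a (fun t => 'D_(eta t) g (gamma t)) t0 =
    'D_('D_a eta t0) g (gamma t0) +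
    'D_('D_a gamma t0) (fun q => 'D_(eta t0) g q) (gamma t0).
Proof.
move=> oU sg Ut0 dgam deta.
have sgj j := smooth_on_derive (delta_mx 0 j) sg.
pose G (q : 'rV[R]_n) : 'rV[R]_n := \row_j 'D_(delta_mx 0 j) g q.
have sG : smooth_on U G.
  move=> k; apply: (Ck_on_mx oU) => i j.
  by apply: (Ck_on_eq oU _ (sgj j k)) => q _; rewrite mxE.
have dG := smooth_on_differentiable sG Ut0.
have gE b q : U q -> 'D_b g q = dotv b (G q).
  move=> Uq; rewrite (derive_sum_partial _ (smooth_on_differentiable sg Uq)).
  by apply: eq_bigr => j _; rewrite mxE.
have dGgam : differentiable (G \o gamma) t0 by exact: differentiable_comp.
have nearE : \near t0, dotv (eta t0) ((G \o gamma) t0) = 'D_(eta t0) g (gamma t0).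
  have cgam : nbhs t0 (gamma @^-1` U).
    by apply: (differentiable_continuous dgam); exact: open_nbhs_nbhs.
  by apply: filterS cgam => t Ut; rewrite gE.
have [dd DD] := is_derive_dot a deta dGgam.
have ddot : differentiable (fun t => dotv (eta t) ((G \o gamma) t)) t0.
  have -> : (fun t => dotv (eta t) ((G \o gamma) t)) =
      \sum_(i < n) (fun t => eta t 0 i * (G \o gamma) t 0 i).
    by apply/funext => q; rewrite /dotv fct_sumE.
  apply: differentiable_sum => i; apply: differentiableM.
    exact: (differentiable_comp deta (differentiable_coord (eta t0) 0 i)).
  exact: (differentiable_comp dGgam (differentiable_coord ((G \o gamma) t0) 0 i)).
split; first exact: near_eq_differentiable nearE ddot.
apply: (etrans (esym (near_eq_derive a nearE))).
apply: (etrans DD); rewrite (gE _ _ Ut0); congr (_ + _).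
have -> : 'D_a (G \o gamma) t0 = 'D_('D_a gamma t0) G (gamma t0).
  rewrite (deriveE _ dGgam) (diff_comp dgam dG) (deriveE _ dG) (deriveE _ dgam).
  by [].
rewrite dotvC -(derive_dot_cst _ _ dG).
apply: near_eq_derive; apply: (open_near_eq oU _ Ut0) => q Uq.
by rewrite (gE _ _ Uq) dotvC.
Qed.

End derive_along_curve.

Section cross_product.
Context {R : realType}.

Definition row3 (a b c : R) : 'rV[R]_3 := \row_j [:: a; b; c]`_j.

Definition ord3 k (Hk : (k < 3)%N) : 'I_3 := Ordinal Hk.
Notation o0 := (@ord3 0 isT).
Notation o1 := (@ord3 1 isT).
Notation o2 := (@ord3 2 isT).

Definition cross (a b : 'rV[R]_3) : 'rV[R]_3 :=
  row3 (a 0 o1 * b 0 o2 - a 0 o2 * b 0 o1) (a 0 o2 * b 0 o0 - a 0 o0 * b 0 o2)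
       (a 0 o0 * b 0 o1 - a 0 o1 * b 0 o0).

Lemma dotv3E (x y : 'rV[R]_3) :
  dotv x y = x 0 o0 * y 0 o0 + x 0 o1 * y 0 o1 + x 0 o2 * y 0 o2.
Proof.
rewrite /dotv !big_ord_recl big_ord0 addr0 addrA.
by congr (_ + _ + _); congr (x 0 _ * y 0 _); exact: val_inj.
Qed.

Lemma dotv_cross (x a b : 'rV[R]_3) : dotv x (cross a b) =
  x 0 o0 * (a 0 o1 * b 0 o2 - a 0 o2 * b 0 o1) +
  x 0 o1 * (a 0 o2 * b 0 o0 - a 0 o0 * b 0 o2) +
  x 0 o2 * (a 0 o0 * b 0 o1 - a 0 o1 * b 0 o0).
Proof. by rewrite dotv3E !mxE. Qed.

Lemma triple_product_gram (x y a b : 'rV[R]_3) :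
  dotv x (cross a b) * dotv y (cross a b) =
  dotv x y * (dotv a a * dotv b b - dotv a b * dotv a b)
  - dotv x a * (dotv a y * dotv b b - dotv a b * dotv b y)
  + dotv x b * (dotv a y * dotv a b - dotv a a * dotv b y).
Proof. rewrite !dotv_cross !dotv3E; ring. Qed.

Lemma det_rows3 (a b c : 'rV[R]_3) :
  \det (col_mx a (col_mx b c) : 'M[R]_(1 + (1 + 1))) = dotv b (cross c a).
Proof.
set A := col_mx _ _; pose A' i j := A (inord i) (inord j).
(* entries are read through natural numbers, so that indices produced by the
   expansions compute to literals *)
have AE i j : A i j = A' i j by rewrite /A' !inord_val.
have aE (j : 'I_3) : a 0 j = A' 0%N j.
  by transitivity (A (lshift (1 + 1) 0) j); [rewrite col_mxEu|exact: AE].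
have bE (j : 'I_3) : b 0 j = A' 1%N j.
  transitivity (A (rshift 1 (lshift 1 0)) j); last exact: AE.
  by rewrite col_mxEd col_mxEu.
have cE (j : 'I_3) : c 0 j = A' 2%N j.
  transitivity (A (rshift 1 (rshift 1 0)) j); last exact: AE.
  by rewrite !col_mxEd.
rewrite dotv_cross !aE !bE !cE /=; clearbody A'; clear aE bE cE; clearbody A.
rewrite (expand_det_row _ ord0) !big_ord_recl big_ord0 /cofactor.
rewrite !(expand_det_row _ ord0) !big_ord_recl !big_ord0 /cofactor !det_mx11 !mxE.
rewrite !AE /= /bump /=.
ring.
Qed.

Lemma Ck_on_cross (V : normedModType R) k (U : set V) (F G : V -> 'rV[R]_3) : open U ->
  Ck_on k U F -> Ck_on k U G -> Ck_on k U (fun q => cross (F q) (G q)).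
Proof.
move=> oU CF CG; apply: (Ck_on_mx oU) => i j.
have C1 a b : Ck_on k U (fun q => F q 0 a * G q 0 b - F q 0 b * G q 0 a).
  have cM (x y : 'I_3) := Ck_onM oU (Ck_on_coord 0 x oU CF) (Ck_on_coord 0 y oU CG).
  have cN := Ck_onM oU (@Ck_on_cst _ V R k U (-1)) (cM b a).
  apply: (Ck_on_eq oU _ (Ck_onD oU (cM a b) cN)).
  by move=> q _; rewrite mulN1r.
case: j => -[|[|[|//]]] Hj; [move: (C1 o1 o2)|move: (C1 o2 o0)|move: (C1 o0 o1)];
  by apply: (Ck_on_eq oU) => q _; rewrite mxE.
Qed.

End cross_product.

(** * Jets of the height function of a front *)

Section front.
Context {R : realType}.
Variables (Sigma : set 'rV[R]_2) (f nu : 'rV[R]_2 -> 'rV[R]_3).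
Hypotheses (oS : open Sigma) (frontf : front_on Sigma f nu).

Lemma derive_eq_on (g h : 'rV[R]_2 -> R) q a : (forall q, Sigma q -> g q = h q) ->
  Sigma q -> 'D_a g q = 'D_a h q.
Proof. by move=> gh Sq; apply: near_eq_derive; exact: open_near_eq oS gh Sq. Qed.

Let sf : smooth_on Sigma f. Proof. by case: frontf. Qed.
Let sn : smooth_on Sigma nu. Proof. by case: frontf. Qed.

Lemma front_tangent a q : Sigma q -> dotv ('D_a f q) (nu q) = 0.
Proof.
move=> Sq; case: frontf => _ _ _ /(_ q a Sq) <- _.
by rewrite (deriveE _ (smooth_on_differentiable sf Sq)).
Qed.

Lemma derive_dot_on (F G : 'rV[R]_2 -> 'rV[R]_3) a q :
  smooth_on Sigma F -> smooth_on Sigma G -> Sigma q ->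
  'D_a (fun q => dotv (F q) (G q)) q =
    dotv ('D_a F q) (G q) + dotv (F q) ('D_a G q).
Proof.
move=> sF sG Sq; exact: derive_dot (smooth_on_differentiable sF Sq)
  (smooth_on_differentiable sG Sq).
Qed.

Lemma front_tangent2 b a q : Sigma q ->
  dotv ('D_b (fun q => 'D_a f q) q) (nu q) + dotv ('D_a f q) ('D_b nu q) = 0.
Proof.
move=> Sq; apply: etrans (esym (derive_dot_on b (smooth_on_derive a sf) sn Sq)) _.
apply: etrans (derive_eq_on b (h := fun=> 0) _ Sq) _; last exact: derive_cst.
by move=> q' Sq'; exact: front_tangent.
Qed.

Lemma front_tangent3 c b a q : Sigma q ->
  dotv ('D_c (fun q => 'D_b (fun q => 'D_a f q) q) q) (nu q) +
  dotv ('D_b (fun q => 'D_a f q) q) ('D_c nu q) +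
  (dotv ('D_c (fun q => 'D_a f q) q) ('D_b nu q) +
  dotv ('D_a f q) ('D_c (fun q => 'D_b nu q) q)) = 0.
Proof.
move=> Sq; have sa := smooth_on_derive a sf; have sba := smooth_on_derive b sa.
have sb := smooth_on_derive b sn.
rewrite -(derive_dot_on c sba sn Sq) -(derive_dot_on c sa sb Sq).
have sdot (F G : 'rV[R]_2 -> 'rV[R]_3) : smooth_on Sigma F -> smooth_on Sigma G ->
    derivable (fun q => dotv (F q) (G q)) q c.
  move=> sF sG; apply: diff_derivable.
  exact: (Ck_on_dot oS (sF 1%N) (sG 1%N)).1.
apply: etrans (esym (deriveD (sdot _ _ sba sn) (sdot _ _ sa sb))) _.
apply: etrans (derive_eq_on c (h := fun=> 0) _ Sq) _; last exact: derive_cst.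
by move=> q' Sq'; exact: front_tangent2.
Qed.

Lemma front_normal a q : Sigma q -> dotv ('D_a nu q) (nu q) = 0.
Proof.
move=> Sq; have := derive_dot_on a sn sn Sq.
have -> : 'D_a (fun q => dotv (nu q) (nu q)) q = 0.
  apply: etrans (derive_eq_on a (h := fun=> 1) _ Sq) _; last exact: derive_cst.
  by move=> q' Sq'; case: frontf => _ _ /(_ q' Sq').
rewrite (dotvC (nu q)) -mulr2n => /esym/eqP; rewrite mulrn_eq0 /=.
by move/eqP.
Qed.

Lemma front_immersion a q : Sigma q -> 'D_a f q = 0 -> 'D_a nu q = 0 -> a = 0.
Proof.
move=> Sq; have df := smooth_on_differentiable sf Sq.
have dn := smooth_on_differentiable sn Sq.
rewrite (deriveE _ df) (deriveE _ dn) => f0 n0.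
case: frontf => _ _ _ _ [_ /(_ q Sq) inj]; apply: inj.
have pE b : 'd (fun q => (f q, nu q)) q b = ('d f q b, 'd nu q b).
  exact: (congr1 (@^~ b) (diff_pair df dn)).
apply: etrans (pE a) _; apply: etrans _ (esym (pE 0)).
have fE : 'd f q 0 = 0 by exact: linear0.
have nE : 'd nu q 0 = 0 by exact: linear0.
exact: (congr2 pair (etrans f0 (esym fE)) (etrans n0 (esym nE))).
Qed.

Variable p : 'rV[R]_2.
Hypothesis pS : Sigma p.
Let phi := extended_height f nu p.

Lemma height_smooth : smooth_on Sigma phi.
Proof.
move=> k; apply: (Ck_onD oS); last exact: Ck_on_cst.
exact: Ck_on_dot_cst (sf k).
Qed.

Lemma derive_height a q : Sigma q -> 'D_a phi q = dotv ('D_a f q) (nu p).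
Proof.
move=> Sq; have df := smooth_on_differentiable sf Sq.
rewrite -(derive_dot_cst _ _ df).
have dd : derivable (fun q => dotv (f q) (nu p)) q a.
  by apply: diff_derivable; exact: (Ck_on_dot_cst _ oS (sf 1%N)).1.
have := @deriveB _ _ _ _ _ q a dd (@derivable_cst _ _ _ (dotv (f p) (nu p)) q a).
by rewrite derive_cst subr0.
Qed.

Lemma derive2_height b a q : Sigma q ->
  derive2 b a phi q = dotv ('D_b (fun q => 'D_a f q) q) (nu p).
Proof.
move=> Sq; have da := smooth_on_differentiable (smooth_on_derive a sf) Sq.
apply: etrans _ (derive_dot_cst _ _ da).
by apply: derive_eq_on Sq => q'; exact: derive_height.
Qed.

Lemma derive3_height c b a q : Sigma q -> derive3 c b a phi q =
  dotv ('D_c (fun q => 'D_b (fun q => 'D_a f q) q) q) (nu p).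
Proof.
move=> Sq.
have da := smooth_on_differentiable (smooth_on_derive b (smooth_on_derive a sf)) Sq.
apply: etrans _ (derive_dot_cst _ _ da).
by apply: derive_eq_on Sq => q'; exact: derive2_height.
Qed.

Lemma derive2_heightC b a q : Sigma q -> derive2 b a phi q = derive2 a b phi q.
Proof. by move=> Sq; exact: derive_comm oS (height_smooth 2%N) Sq. Qed.

Lemma derive3_heightCr c b a q : Sigma q -> derive3 c b a phi q = derive3 c a b phi q.
Proof.
by move=> Sq; apply: derive_eq_on Sq => q' Sq'; exact: derive2_heightC.
Qed.

Lemma derive3_heightCl c b a q : Sigma q -> derive3 c b a phi q = derive3 b c a phi q.
Proof.
by move=> Sq; exact: derive_comm oS (smooth_on_derive a height_smooth 2%N) Sq.
Qed.

(** Derivatives of f paired with nu p are traded, through [front_tangent2] and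
    [front_tangent3], for lower order ones paired with derivatives of nu. In this form
    everything that contains df in a null direction drops out. *)
Lemma height_hessian b a : derive2 b a phi p = - dotv ('D_a f p) ('D_b nu p).
Proof.
by rewrite (derive2_height _ _ pS); apply/eqP; rewrite -addr_eq0 front_tangent2.
Qed.

Lemma height_third c b a : derive3 c b a phi p =
  - (dotv ('D_b (fun q => 'D_a f q) p) ('D_c nu p) +
     dotv ('D_c (fun q => 'D_a f q) p) ('D_b nu p) +
     dotv ('D_a f p) ('D_c (fun q => 'D_b nu q) p)).
Proof.
have alg (x y z t : R) : x + y + (z + t) = 0 -> x = - (y + z + t).
  by move=> /eqP; rewrite -!addrA addr_eq0 => /eqP.
rewrite (derive3_height _ _ _ pS); exact: alg (front_tangent3 c b a pS).
Qed.

End front.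

(** * Singular points of the second kind *)

Lemma dotv_cross_comb (R : realType) (a b c : 'rV[R]_3) (v w : 'rV[R]_2) :
  dotv (w 0 0 *: a + w 0 1 *: b) (cross c (v 0 0 *: a + v 0 1 *: b)) =
  (v 0 0 * w 0 1 - v 0 1 * w 0 0) * dotv b (cross c a).
Proof. rewrite !dotv_cross !mxE; ring. Qed.

Lemma derive_partial2 (R : realType) (W : normedModType R) (F : 'rV[R]_2 -> W) x v :
  differentiable F x ->
  'D_v F x = v 0 0 *: 'D_(delta_mx 0 0) F x + v 0 1 *: 'D_(delta_mx 0 1) F x.
Proof.
move=> dF; have sum2 (G : 'I_2 -> W) : \sum_j G j = G 0 + G 1.
  by rewrite big_ord_recl big_ord1; congr (_ + G _); exact: val_inj.
exact: etrans (derive_sum_partial v dF) (sum2 _).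
Qed.

Section second_kind.
Context {R : realType}.
Variables (Sigma : set 'rV[R]_2) (f nu : 'rV[R]_2 -> 'rV[R]_3) (p : 'rV[R]_2).
Hypotheses (oS : open Sigma) (frontf : front_on Sigma f nu) (pS : Sigma p).

Let sf : smooth_on Sigma f. Proof. by case: frontf. Qed.
Let sn : smooth_on Sigma nu. Proof. by case: frontf. Qed.

Lemma dependent_rows (a b : 'rV[R]_2) : a != 0 -> b != 0 ->
  \det (col_mx a b : 'M[R]_(1 + 1)) = 0 -> exists2 k : R, k != 0 & a = k *: b.
Proof.
move=> a0 b0 /eqP/det0P[z z0].
rewrite -[z]hsubmxK mul_row_col [lsubmx z]mx11_scalar [rsubmx z]mx11_scalar.
rewrite !mul_scalar_mx; set x := lsubmx z 0 0; set y := rsubmx z 0 0 => xy0.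
have x0 : x != 0.
  apply/eqP => x0; move: xy0; rewrite x0 scale0r add0r => /eqP.
  rewrite scaler_eq0 (negbTE b0) orbF => /eqP y0; move/eqP: z0; apply.
  rewrite -[z]hsubmxK [lsubmx z]mx11_scalar [rsubmx z]mx11_scalar -/x -/y x0 y0.
  by rewrite raddf0 row_mx0.
have aE : a = (- (x^-1 * y)) *: b.
  apply: (scalerI x0); rewrite scalerA mulrN mulVKf// scaleNr.
  by apply/eqP; rewrite -addr_eq0 xy0.
exists (- (x^-1 * y)) => //; apply: contra_neq a0 => k0.
by rewrite aE k0 scale0r.
Qed.

(** Differentiating df(eta) = 0 along the singular curve, whose velocity is
    parallel to eta at p, puts the second null derivative in the image of df. *)
Lemma second_kind_null : second_kind Sigma f nu p ->
  exists w : 'rV[R]_2, [/\ w != 0, 'D_w f p = 0 &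
    exists u : 'rV[R]_2, forall c,
      dotv ('D_w (fun q => 'D_w f q) p) c = dotv ('D_u f p) c].
Proof.
move=> [_ [e [gamma [eta [e0 [sg g0 dg0 [W [oW Wp WS] WE]] [se eta0 null] dep]]]]].
have i0 : sym_ival e 0 by rewrite /sym_ival/= in_itv/= oppr_lt0 e0.
have oi : open (sym_ival e) by exact: interval_open.
have gS t : sym_ival e t -> Sigma (gamma t).
  move=> it; apply: WS.
  have : (gamma @` sym_ival e) (gamma t) by exists t.
  by rewrite -WE => -[].
have [k k0 kE] := dependent_rows (dg0 0 i0) (eta0 0 i0) dep.
set w := eta 0 in kE *; rewrite derive1E in kE.
have df q : Sigma q -> differentiable f q by exact: smooth_on_differentiable.
exists w; split; first exact: eta0.
  by rewrite (deriveE _ (df p pS)) -g0; exact: null.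
exists (- k^-1 *: 'D_1 eta 0) => c.
have scf : smooth_on Sigma (fun q => dotv (f q) c).
  by move=> j; exact: Ck_on_dot_cst (sf j).
have [_ DD] := derive_along_curve (1 : R) oS scf (gS 0 i0)
  (smooth_on_differentiable sg i0) (smooth_on_differentiable se i0).
have L0 : 'D_1 (fun t => 'D_(eta t) (fun q => dotv (f q) c) (gamma t)) (0 : R) = 0.
  apply: etrans (derive_cst (0 : R) (0 : R) 1).
  apply: near_eq_derive; apply: (open_near_eq oi _ i0) => t it.
  rewrite (derive_dot_cst _ _ (df _ (gS t it))) (deriveE _ (df _ (gS t it))).
  by rewrite null// dotv0l.
have sw := smooth_on_derive w sf.
have dw := smooth_on_differentiable sw pS.
have D2 : 'D_(k *: w) (fun q => 'D_w (fun q => dotv (f q) c) q) p =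
    k * dotv ('D_w (fun q => 'D_w f q) p) c.
  rewrite -dotvZl -(deriveZv _ _ dw) -(derive_dot_cst _ _ dw).
  apply: near_eq_derive; apply: (open_near_eq oS _ pS) => q Sq.
  exact: derive_dot_cst (df q Sq).
have D1 : 'D_('D_1 eta 0) (fun q => dotv (f q) c) p = dotv ('D_('D_1 eta 0) f p) c.
  exact: derive_dot_cst (df p pS).
move: DD; rewrite kE g0 => DD.
have E := etrans (esym L0) (etrans DD (congr2 +%R D1 D2)).
rewrite (deriveZv _ _ (df p pS)) dotvZl.
have alg (x y : R) : 0 = x + k * y -> y = - k^-1 * x.
  move=> xy; apply: (mulfI k0); rewrite mulrA mulrN mulfV// mulN1r.
  by apply/eqP; rewrite -addr_eq0 addrC -xy.
exact: alg E.
Qed.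

(** The triple product of D_w f, nu and D_v f is a nonzero multiple of the signed area
    density; since D_w f vanishes at p, its derivative only involves that of D_w f. *)
Lemma nondegenerate_transversal (v w : 'rV[R]_2) :
  v 0 0 * w 0 1 - v 0 1 * w 0 0 != 0 -> 'D_w f p = 0 ->
  nondegenerate_singular_point f nu p ->
  exists X : 'rV[R]_2,
    dotv ('D_X (fun q => 'D_w f q) p) (cross (nu p) ('D_v f p)) != 0.
Proof.
set d := v 0 0 * _ - _ => d0 w0 [_ [X]].
pose fu q := 'D_(delta_mx 0 0) f q; pose fv q := 'D_(delta_mx 0 1) f q.
have su : smooth_on Sigma fu by exact: smooth_on_derive.
have sv : smooth_on Sigma fv by exact: smooth_on_derive.
have lE : signed_area_density f nu = fun q => dotv (fv q) (cross (nu q) (fu q)).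
  by apply/funext => q; exact: det_rows3.
have sl k : Ck_on k Sigma (fun q => dotv (fv q) (cross (nu q) (fu q))).
  exact: Ck_on_dot oS (sv k) (Ck_on_cross oS (sn k) (su k)).
have dl := (sl 1%N).1 p pS.
have sDv := smooth_on_derive v sf; have sDw := smooth_on_derive w sf.
have muE q : Sigma q -> dotv ('D_w f q) (cross (nu q) ('D_v f q)) =
    d * dotv (fv q) (cross (nu q) (fu q)).
  move=> Sq; have df := smooth_on_differentiable sf Sq.
  have fE a : 'D_a f q = a 0 0 *: fu q + a 0 1 *: fv q by exact: derive_partial2.
  apply: etrans (congr2 (fun x y => dotv x (cross (nu q) y)) (fE w) (fE v)) _.
  exact: dotv_cross_comb.
rewrite lE -(deriveE _ dl) => lX; exists X; apply: contra_neq lX => DX0.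
have dm := derive_dot X (smooth_on_differentiable sDw pS)
  ((Ck_on_cross oS (sn 1%N) (sDv 1%N)).1 p pS).
have m0 : 'D_X (fun q => dotv ('D_w f q) (cross (nu q) ('D_v f q))) p = 0.
  by apply: etrans dm _; rewrite DX0 w0 dotv0l addr0.
pose g q := dotv (fv q) (cross (nu q) (fu q)).
have e1 : 'D_X (fun q => d * g q) p = d * 'D_X g p.
  exact: (@deriveZ _ _ _ g d p X (@diff_derivable _ _ _ g p X dl)).
have e2 : 'D_X (fun q => dotv ('D_w f q) (cross (nu q) ('D_v f q))) p =
    'D_X (fun q => d * g q) p.
  by apply: near_eq_derive; exact: open_near_eq oS muE pS.
apply: (mulfI d0); rewrite mulr0.
exact: etrans (esym e1) (etrans (esym e2) m0).
Qed.

End second_kind.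

(** * The bounded principal curvature *)

Section principal.
Context {R : realType}.

(** The vectors c x a and n are proportional: both are orthogonal to a and c. *)
Lemma triple_product_orthogonal (a b c n : 'rV[R]_3) :
  dotv c c = 1 -> a != 0 -> n != 0 -> dotv c a = 0 -> dotv c n = 0 ->
  dotv a n = 0 -> dotv b n = 0 -> dotv b (cross c a) = 0.
Proof.
move=> cc a0 n0 ca cn an bn.
have nn : dotv n (cross c a) != 0.
  apply/eqP => n1; have := triple_product_gram n n c a.
  rewrite n1 cc ca (dotvC n c) (dotvC n a) cn an !(mul0r, mulr0) !(subr0, addr0) mul1r.
  move/esym/eqP; rewrite mulf_eq0.
  by case/orP => /eqP /dotvv_eq0 /eqP; [rewrite (negbTE n0)|rewrite (negbTE a0)].
apply: (mulIf nn); rewrite mul0r triple_product_gram bn cn ca an.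
by ring.
Qed.

Lemma frame_decomposition (v w u : 'rV[R]_2) :
  (forall x y : R, x *: v + y *: w = 0 -> x = 0 /\ y = 0) ->
  exists x y : R, u = x *: v + y *: w.
Proof.
move=> vw; pose z := u *m invmx (frame v w).
by exists (z 0 0), (z 0 1); rewrite -mul_frame mulmxKV// frame_unit.
Qed.

Variables (Sigma : set 'rV[R]_2) (f nu : 'rV[R]_2 -> 'rV[R]_3) (p : 'rV[R]_2).
Hypotheses (oS : open Sigma) (frontf : front_on Sigma f nu) (pS : Sigma p).

Let sf : smooth_on Sigma f. Proof. by case: frontf. Qed.
Let sn : smooth_on Sigma nu. Proof. by case: frontf. Qed.

(** Differentiation of dnu(V) = - kappa df(V) along V at a zero of kappa; [u]
    is the derivative of V along itself. *)
Lemma principal_second_derivative kappa V :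
  differentiable kappa p -> kappa p = 0 -> principal_vector Sigma f nu p kappa V ->
  exists u : 'rV[R]_2, forall c,
    dotv ('D_(V p) (fun q => 'D_(V p) nu q) p) c =
    - ('D_(V p) kappa p * dotv ('D_(V p) f p) c) - dotv ('D_u nu p) c.
Proof.
move=> dkappa kappa0 [U [[oU Up US] sV _ rel]]; set v := V p.
exists ('D_v V p) => c.
pose g q := dotv (nu q) c; pose h q := dotv (f q) c.
have df q : U q -> differentiable f q.
  by move=> /US Sq; exact: smooth_on_differentiable sf Sq.
have dn q : U q -> differentiable nu q.
  by move=> /US Sq; exact: smooth_on_differentiable sn Sq.
have sg : smooth_on U g.
  by move=> k; apply: (Ck_on_dot_cst _ oU); exact: Ck_on_sub US (sn k).
have sh : smooth_on U h.
  by move=> k; apply: (Ck_on_dot_cst _ oU); exact: Ck_on_sub US (sf k).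
have did : differentiable (@id 'rV[R]_2) p by exact: ex_diff.
have dV := smooth_on_differentiable sV Up.
have [_ Dg] := derive_along_curve v oU sg Up did dV.
have [dK _] := derive_along_curve v oU sh Up did dV.
set K := fun q => 'D_(V q) h (id q) in dK.
have relE q : U q -> 'D_(V q) g (id q) = (-1) * (kappa q * K q).
  move=> Uq; have dfq := df q Uq; have dnq := dn q Uq.
  apply: etrans (derive_dot_cst _ _ dnq) _.
  have KE : K q = dotv ('D_(V q) f q) c by exact: derive_dot_cst dfq.
  rewrite KE (deriveE _ dnq) (rel q Uq) -(deriveE _ dfq) dotvZl.
  by rewrite mulN1r mulNr.
have dKv := @diff_derivable _ _ _ K p v dK.
have dkv := @diff_derivable _ _ _ kappa p v dkappa.
have Kp : K p = dotv ('D_v f p) c by exact: derive_dot_cst (df p Up).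
have e1 : 'D_v (fun q => 'D_(V q) g (id q)) p = - ('D_v kappa p * dotv ('D_v f p) c).
  apply: etrans (near_eq_derive v (open_near_eq oU relE Up)) _.
  have dM : derivable (fun q => kappa q * K q) p v := derivableM dkv dKv.
  apply: etrans (@deriveZ _ _ _ (fun q => kappa q * K q) (-1) p v dM) _.
  have DM : 'D_v (fun q => kappa q * K q) p = kappa p * 'D_v K p + K p * 'D_v kappa p.
    exact: deriveM dkv dKv.
  rewrite DM kappa0 Kp mul0r add0r scaleN1r.
  by rewrite [X in - X]mulrC.
have e2 : 'D_('D_v id p) (fun q => 'D_(V p) g q) (id p) =
    dotv ('D_v (fun q => 'D_v nu q) p) c.
  rewrite derive_id.
  have dvn := smooth_on_differentiable (smooth_on_derive v sn) pS.
  apply: etrans _ (derive_dot_cst _ _ dvn).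
  apply: near_eq_derive; apply: (open_near_eq oU _ Up) => q Uq.
  exact: derive_dot_cst (dn q Uq).
have e3 : 'D_('D_v V p) g (id p) = dotv ('D_('D_v V p) nu p) c.
  exact: derive_dot_cst (dn p Up).
have alg (x y z t : R) : x = - t -> x = y + z -> z = - t - y.
  by move=> -> ->; rewrite addrAC subrr add0r.
exact: alg e1 (etrans Dg (congr2 +%R e3 e2)).
Qed.

End principal.

(** * D4 singularities of the height function *)

Section height_jet.
Context {R : realType}.
Variables (Sigma : set 'rV[R]_2) (f nu : 'rV[R]_2 -> 'rV[R]_3) (p : 'rV[R]_2).
Hypotheses (oS : open Sigma) (frontf : front_on Sigma f nu) (pS : Sigma p).
Local Notation phi := (extended_height f nu p).

Let sf : smooth_on Sigma f. Proof. by case: frontf. Qed.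
Let sn : smooth_on Sigma nu. Proof. by case: frontf. Qed.
Let df : differentiable f p. Proof. exact: smooth_on_differentiable sf pS. Qed.
Let dn : differentiable nu p. Proof. exact: smooth_on_differentiable sn pS. Qed.

Variables (v w : 'rV[R]_2) (k : R).
Hypotheses (v0 : v != 0) (w0 : w != 0) (fw0 : 'D_w f p = 0)
  (nuv : 'D_v nu p = - k *: 'D_v f p).

Lemma principal_image_neq0 : 'D_v f p != 0.
Proof.
apply: contra_neq v0 => fv0; apply: (front_immersion frontf pS fv0).
by rewrite nuv fv0 scaler0.
Qed.

Lemma null_normal_neq0 : 'D_w nu p != 0.
Proof.
by apply: contra_neq w0 => nw0; exact: (front_immersion frontf pS fw0 nw0).
Qed.

Lemma principal_null_free (x y : R) : x *: v + y *: w = 0 -> x = 0 /\ y = 0.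
Proof.
move=> xy; have x0 : x = 0.
  have : 'D_(x *: v + y *: w) f p = 0 by rewrite xy (deriveE _ df); exact: linear0.
  rewrite (deriveDv _ _ df) !(deriveZv _ _ df) fw0 scaler0 addr0 => /eqP.
  by rewrite scaler_eq0 (negbTE principal_image_neq0) orbF => /eqP.
move: xy; rewrite x0 scale0r add0r => /eqP.
by rewrite scaler_eq0 (negbTE w0) orbF => /eqP.
Qed.

Lemma height_hessian_null b : derive2 b w phi p = 0.
Proof. by rewrite (height_hessian oS frontf pS) fw0 dotv0l oppr0. Qed.

(** Symmetry of the Hessian of the height function: a null direction is conjugate to
    every direction. *)
Lemma principal_image_normal : dotv ('D_v f p) ('D_w nu p) = 0.
Proof.
have := derive2_heightC oS frontf p v w pS.
rewrite height_hessian_null (height_hessian oS frontf pS) => /esym/eqP.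
by rewrite oppr_eq0 => /eqP.
Qed.

Lemma height_hessian_principal :
  derive2 v v phi p = k * dotv ('D_v f p) ('D_v f p).
Proof. by rewrite (height_hessian oS frontf pS) nuv dotvZr mulNr opprK. Qed.

Hypothesis k0 : k = 0.

Let nuv0 : 'D_v nu p = 0. Proof. by rewrite nuv k0 oppr0 scale0r. Qed.

Lemma height_third_null c b : derive3 c b w phi p =
  - (dotv ('D_b (fun q => 'D_w f q) p) ('D_c nu p) +
     dotv ('D_c (fun q => 'D_w f q) p) ('D_b nu p)).
Proof. by rewrite (height_third oS frontf pS) fw0 dotv0l addr0. Qed.

Lemma height_mixed_principal : derive3_mixed v w phi p = 0.
Proof.
rewrite /derive3_mixed (derive3_heightCl oS frontf p w v v pS).
rewrite (derive3_heightCr oS frontf p v w v pS) height_third_null nuv0 !dotv0r.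
by rewrite addr0 oppr0 !addr0.
Qed.

Lemma height_mixed_null : derive3_mixed w v phi p =
  - 3 * dotv ('D_v (fun q => 'D_w f q) p) ('D_w nu p).
Proof.
have e1 : derive3 w v w phi p = derive3 v w w phi p.
  exact: (derive3_heightCl oS frontf p w v w pS).
have e0 : derive3 w w v phi p = derive3 v w w phi p.
  exact: (etrans (derive3_heightCr oS frontf p w w v pS) e1).
have e2 : derive3 v w w phi p = - dotv ('D_v (fun q => 'D_w f q) p) ('D_w nu p).
  have alg (x y : R) : x = 0 -> - (x + y) = - y by move=> ->; rewrite add0r.
  exact: (etrans (height_third_null v w)
    (alg _ _ (etrans (congr1 (dotv _) nuv0) (dotv0r _)))).
have alg (x y z t : R) : x = - t -> y = - t -> z = - t -> x + y + z = - 3 * t.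
  by move=> -> -> ->; ring.
exact: (alg _ _ _ _ (etrans e0 e2) (etrans e1 e2) e2).
Qed.

End height_jet.

Theorem theorem4p3 (R : realType) (Sigma : set 'rV[R]_2)
    (f nu : 'rV[R]_2 -> 'rV[R]_3) (p : 'rV[R]_2)
    (kappa : 'rV[R]_2 -> R) (V : 'rV[R]_2 -> 'rV[R]_2)
    (Sigma_open : open Sigma) (Sigma_connected : connected Sigma)
    (f_front : front_on Sigma f nu)
    (p_Sigma : Sigma p)
    (p_second_kind : second_kind Sigma f nu p)
    (kappaP : bounded_principal_curvature Sigma f nu p kappa)
    (VP : principal_vector Sigma f nu p kappa V) :
  D4_singularity (extended_height f nu p) p <->
  parabolic_point kappa p /\ ~ ridge_point kappa V p.
Proof.
have [sf sn] : smooth_on Sigma f /\ smooth_on Sigma nu by case: f_front.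
have df := smooth_on_differentiable sf p_Sigma.
have dn := smooth_on_differentiable sn p_Sigma.
have nu1 : dotv (nu p) (nu p) = 1 by case: f_front => _ _ /(_ p p_Sigma).
have dk : differentiable kappa p.
  by have [U [[_ Up _] sk _]] := kappaP; exact: smooth_on_differentiable sk Up.
have [v0 nuv] : V p != 0 /\ 'D_(V p) nu p = - kappa p *: 'D_(V p) f p.
  have [U [[_ Up _] _ V0 rel]] := VP; split; first exact: V0.
  by rewrite (deriveE _ dn) (deriveE _ df); exact: rel.
have [w [w0 fw0 [u0 fwwE]]] := second_kind_null Sigma_open f_front p_Sigma p_second_kind.
set v := V p in v0 nuv *.
have fv0 := principal_image_neq0 f_front p_Sigma v0 nuv.
have nw0 := null_normal_neq0 f_front p_Sigma w0 fw0.
have free := principal_null_free f_front p_Sigma v0 w0 fw0 nuv.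
have fvnw := principal_image_normal Sigma_open f_front p_Sigma v fw0.
pose A := dotv ('D_v f p) ('D_v f p).
have A0 : A != 0 by apply: contra_neq fv0; exact: dotvv_eq0.
have hvv := height_hessian_principal Sigma_open f_front p_Sigma nuv.
have parab : derive2 v v (extended_height f nu p) p = 0 <-> kappa p = 0.
  rewrite hvv; split=> [/eqP|->]; last by rewrite mul0r.
  by rewrite mulf_eq0 (negbTE A0) orbF => /eqP.
(* the image of df at p is the line spanned by df(v) *)
have tangent a : dotv ('D_a f p) ('D_w nu p) = 0.
  have [x [y ->]] := frame_decomposition a free.
  by rewrite (dotv_derive_comb _ _ _ _ _ df) fvnw fw0 dotv0l !mulr0 addr0.
have fww : dotv ('D_w (fun q => 'D_w f q) p) ('D_w nu p) = 0.
  by rewrite fwwE tangent.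
have sw := smooth_on_derive w sf; have dw := smooth_on_differentiable sw p_Sigma.
have fvw : dotv ('D_v (fun q => 'D_w f q) p) ('D_w nu p) != 0.
  apply/eqP => fvw.
  have [|X] := nondegenerate_transversal Sigma_open f_front p_Sigma _ fw0
      p_second_kind.1 (v := v).
    by apply: (@linear_independent_det _ idfun) => // b.
  have [x [y ->]] := frame_decomposition X free.
  rewrite (dotv_derive_comb _ _ _ _ _ dw).
  have orth b : dotv b ('D_w nu p) = 0 -> dotv b (cross (nu p) ('D_v f p)) = 0.
    exact: (triple_product_orthogonal nu1 fv0 nw0
      (etrans (dotvC _ _) (front_tangent f_front v p_Sigma))
      (etrans (dotvC _ _) (front_normal Sigma_open f_front w p_Sigma)) fvnw).
  have alg (a b : R) : a = 0 -> b = 0 -> ~ (x * a + y * b != 0).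
    by move=> -> ->; rewrite !mulr0 addr0 eqxx.
  exact: (alg _ _ (orth _ fvw) (orth _ fww)).
have /nbhs_ballP[r r0 Br] : nbhs p Sigma by exact: open_nbhs_nbhs.
have BS : [set x | `|x - p| < r] `<=` Sigma.
  by move=> x xr; apply: Br; rewrite -ball_normE /ball_/= distrC.
have sphi := smooth_on_sub BS (height_smooth Sigma_open f_front p).
have phi0 : extended_height f nu p p = 0 by rewrite /extended_height subrr.
have dphi0 (z : 'rV[R]_2) : 'D_z (extended_height f nu p) p = 0.
  by rewrite (derive_height Sigma_open f_front _ _ p_Sigma) (front_tangent f_front).
have hw b := height_hessian_null Sigma_open f_front p_Sigma fw0 b.
have hwv : derive2 w v (extended_height f nu p) p = 0.
  by rewrite (derive2_heightC Sigma_open f_front _ _ _ p_Sigma).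
have crit := D4_criterion r0 sphi phi0 dphi0 free (hw v) hwv (hw w).
have third : kappa p = 0 ->
    derive3 v v v (extended_height f nu p) p = 'D_v kappa p * A.
  move=> k0; have nv0 : 'D_v nu p = 0 by rewrite nuv k0 oppr0 scale0r.
  have [u uE] := principal_second_derivative f_front p_Sigma dk k0 VP.
  rewrite (height_third Sigma_open f_front p_Sigma) nv0 !dotv0r !add0r.
  rewrite dotvC uE -/v -/A.
  suff -> : dotv ('D_u nu p) ('D_v f p) = 0 by rewrite subr0 opprK.
  have [x [y ->]] := frame_decomposition u free.
  by rewrite (dotv_derive_comb _ _ _ _ _ dn) nv0 dotv0l dotvC fvnw !mulr0 addr0.
have jet3 : derive2 v v (extended_height f nu p) p = 0 ->
    [/\ derive3_mixed v w (extended_height f nu p) p = 0,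
     derive3_mixed w v (extended_height f nu p) p != 0 &
     derive3 w w w (extended_height f nu p) p = 0].
  move=> /parab k0; split.
  - exact: (height_mixed_principal Sigma_open f_front p_Sigma fw0 nuv k0).
  - rewrite (height_mixed_null Sigma_open f_front p_Sigma fw0 nuv k0).
    by rewrite mulf_neq0// oppr_eq0 pnatr_eq0.
  - by rewrite (height_third_null Sigma_open f_front p_Sigma fw0) fww addr0 oppr0.
have {}crit := crit jet3.
split=> [/crit[/parab k0]|[k0 ridge]].
  rewrite (third k0) => ridge; split=> // R0; move/eqP: ridge; apply.
  by rewrite [X in X * _]R0 mul0r.
apply/crit; split; first exact/parab.
by rewrite third// mulf_neq0//; apply/eqP.
Qed.
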